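(* Fix $\delta\in(0,1/2)$ and $0<\alpha_0<\alpha_1$. Let $p,n\in\mathbb{N}$ with $p\ge2$ and $\log(1+p)\le\frac n2$, and set $$\tau_{\text{sparse}}^2(p,s,n,\alpha):=\frac{s\log(p\log\log n)}{n}+s\left(\frac{n}{\sqrt{\log(p\log\log n)}}\right)^{-\frac{4\alpha}{4\alpha+1}}.$$ If $\eta\in(0,1)$, then there exists $c_\eta>0$ depending only on $\eta$ such that for all $0<c<c_\eta$ we have $$\inf_\varphi\left\{P_0\{\varphi\ne0\}+\max_{1\le s<p^{1/2-\delta}}\ \sup_{\alpha\in[\alpha_0,\alpha_1]}\ \sup_{\substack{f\in\mathcal{F}(s,\alpha),\\ \|f\|_2\ge c\,\tau_{\text{sparse}}(p,s,n,\alpha)}}P_f\{\varphi\ne1\}\right\}\ge1-\eta.$$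
   Context: Model: one observes the $p$-dimensional Gaussian white noise model $dY_x = f(x)\,dx + \frac{1}{\sqrt n}\,dB_x$, $x\in[0,1]^p$. $P_f$ denotes the law of the observation when the signal is $f$, and $P_0$ the law when $f\equiv 0$. The infimum is over all tests $\varphi$, i.e. measurable functions of the observation with values in $\{0,1\}$. $\|\cdot\|_2$ is the $L^2([0,1]^p)$ norm. $s$ ranges over integers in $[p]=\{1,\dots,p\}$. Parameter space: $\{\psi_k\}_{k\ge1}\subset L^2([0,1])$ is a fixed (known) orthonormal system of functions orthogonal to constants, which does not depend on $\alpha\in[\alpha_0,\alpha_1]$. For $\alpha>0$ and $s\in[p]$, $$\mathscr{T}(s,\alpha):=\left\{\Theta=(\theta_{k,j})\in\mathbb{R}^{\mathbb{N}\times p}:\ \sum_{j=1}^p\mathbbm{1}_{\{\Theta_j\ne0\}}\le s,\ \ \sum_{k=1}^\infty\frac{\theta_{k,j}^2}{k^{-2\alpha}}\le1\text{ for all }j\right\},$$ where $\Theta_j$ is the $j$th column of $\Theta$, and $\mathcal{F}(s,\alpha)$ is the corresponding set of functions $f(x)=\sum_{j=1}^p\sum_{k\ge1}\theta_{k,j}\psi_k(x_j)$ with $\Theta\in\mathscr{T}(s,\alpha)$. Thus $\|f\|_2^2=\sum_{j}\sum_k\theta_{k,j}^2$. Convention: iterated logarithms such as $\log\log n$ are understood to be equal to a universal constant whenever the expression would otherwise be less than one.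
   Formalization: The constant c_η is allowed to depend on the fixed α_0, α_1 (and on the universal constant in the iterated-log convention) as well as on η, since uniformity over all α_0<α_1 is false (p=2, α_1 close to α_0, n large); it remains uniform in δ, p, n, s, α and ψ. *)

(* Defs.v *)
From HB Require Import structures.
From mathcomp Require Import all_boot all_order all_algebra.
From mathcomp Require Import all_classical all_reals all_analysis.

Set Implicit Arguments.
Unset Strict Implicit.
Unset Printing Implicit Defensive.
Import Order.TTheory GRing.Theory Num.Theory.
Import numFieldNormedType.Exports.

Local Open Scope classical_set_scope.
Local Open Scope ring_scope.

Definition leb01 (R : realType) : probability (measurableTypeR R) R :=
  uniform_prob (@ltr01 R).

Definition cons_pair (R : realType) (p : nat)
    (xt : measurableTypeR R * p.-tuple (measurableTypeR R)) :
  p.+1.-tuple (measurableTypeR R) := [tuple of xt.1 :: xt.2].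

Lemma measurable_cons_pair (R : realType) (p : nat) :
  measurable_fun setT (@cons_pair R p).
Proof. by apply: measurable_cons. Qed.

HB.instance Definition _ (R : realType) (p : nat) :=
  isMeasurableFun.Build _ _ _ _ (@cons_pair R p) (@measurable_cons_pair R p).

(* Lebesgue measure on [0,1]^p, seen as a measure on all of R^p that gives mass
   0 to the complement of the cube: the p-fold product of leb01, transported
   along R * R^p = R^(p+1). Functions on the cube are functions on R^p whose
   values outside the cube are irrelevant. *)
Fixpoint cube (R : realType) (p : nat) :
    probability (p.-tuple (measurableTypeR R)) R :=
  match p with
  | 0 => dirac [tuple]
  | q.+1 => distribution (leb01 R \x cube R q)%E (@cons_pair R q)
  end.

Lemma le1_2e (R : realType) : (1 <= (2%:R : R)%:E)%E.
Proof. by rewrite lee_fin ler1n. Qed.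

Definition L2cube (R : realType) (p : nat) := LfunType (cube R p) (le1_2e R).

Definition inner (R : realType) (p : nat) (f g : L2cube R p) : R :=
  \int[cube R p]_x (f x * g x).

Definition norm2 (R : realType) (p : nat) (f : L2cube R p) : \bar R :=
  'N[cube R p]_(2%:R%:E)[EFin \o f]%E.

Definition centered_gaussian (R : realType) (v : R) :
    set (measurableTypeR R) -> \bar R :=
  if v == 0 then \d_(0 : measurableTypeR R) else normal_prob 0 (Num.sqrt v).

Definition independent (R : realType) (d : measure_display)
    (Omega : measurableType d) (P : probability Omega R)
    (m : nat) (X : 'I_m -> {RV P >-> measurableTypeR R}) : Prop :=
  forall A : 'I_m -> set (measurableTypeR R), (forall i, measurable (A i)) ->
    P (\bigcap_i (X i @^-1` A i)) = (\prod_(i < m) P (X i @^-1` A i))%E.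

(* Gaussian white noise dB on [0,1]^p, given by its Wiener integrals
   W g = \int g dB: the isonormal Gaussian process indexed by L^2([0,1]^p),
   i.e. the linear centered Gaussian process with covariance inner. Joint
   Gaussianity is expressed by the independence of the integrals of pairwise
   orthogonal integrands. The sheet itself is B_x = W 1_{[0,x]}. *)
Record white_noise (R : realType) (p : nat) (d : measure_display)
    (Omega : measurableType d) (P : probability Omega R)
    (W : L2cube R p -> {RV P >-> measurableTypeR R}) : Prop := WhiteNoise {
  white_noise_law : forall g (A : set (measurableTypeR R)), measurable A ->
    distribution P (W g) A = centered_gaussian (inner g g) A ;
  white_noise_linear : forall (a : R) g h,
    {ae P, forall w, W (a *: g + h) w = a * W g w + W h w} ;
  white_noise_indep : forall m (g : 'I_m -> L2cube R p),
    (forall i j, i != j -> inner (g i) (g j) = 0) ->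
    independent (fun i => W (g i)) }.

(* An observation y records the integrals y g = \int g dY for all g; the
   observation space carries the sigma-algebra generated by them. *)
Definition cylinder (R : realType) (p : nat) : set (set (L2cube R p -> R)) :=
  [set C | exists g (A : set (measurableTypeR R)),
     measurable A /\ C = [set y | A (y g)]].

Definition observation (R : realType) (p : nat) :=
  g_sigma_algebraType (@cylinder R p).

(* dY = f dx + n^{-1/2} dB, tested against g. *)
Definition observe (R : realType) (p : nat) (d : measure_display)
    (Omega : measurableType d) (P : probability Omega R)
    (W : L2cube R p -> {RV P >-> measurableTypeR R}) (n : nat)
    (f : L2cube R p) (w : Omega) : observation R p :=
  fun g => inner f g + W g w / Num.sqrt n%:R.

Definition law (R : realType) (p : nat) (d : measure_display)
    (Omega : measurableType d) (P : probability Omega R)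
    (W : L2cube R p -> {RV P >-> measurableTypeR R}) (n : nat)
    (f : L2cube R p) : set (observation R p) -> \bar R :=
  pushforward P (observe W n f).

(* Sequences indexed by k >= 1 are shifted: psi k and theta k stand for
   \psi_{k+1} and \theta_{k+1}. *)
Record orthonormal_centered (R : realType)
    (psi : nat -> measurableTypeR R -> R) : Prop := OrthonormalCentered {
  psi_L2 : forall k, psi k \in Lfun (leb01 R) 2%:R%:E ;
  psi_orthonormal : forall k l,
    \int[leb01 R]_x (psi k x * psi l x) = (k == l)%:R ;
  psi_centered : forall k, \int[leb01 R]_x psi k x = 0 }.

Definition sparse_ellipsoid (R : realType) (p s : nat) (alpha : R) :
    set (nat -> 'I_p -> R) :=
  [set theta : nat -> 'I_p -> R |
     (#|[set j : 'I_p | `[< exists k, theta k j != 0%R >]]%SET| <= s)%N /\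
     forall j, (\sum_(0 <= k <oo)
       (theta k j ^+ 2 / (k.+1%:R `^ (- (2%:R * alpha))))%:E <= 1)%E].

(* The double series defining f converges in L^2([0,1]^p), not pointwise. *)
Definition signals (R : realType) (psi : nat -> measurableTypeR R -> R)
    (p s : nat) (alpha : R) : set (L2cube R p) :=
  [set f | exists2 theta, sparse_ellipsoid s alpha theta &
     'N[cube R p]_(2%:R%:E)[(fun x =>
        (f x - \sum_(j < p) \sum_(k < N) theta k j * psi k (tnth x j))%:E)]%E
     @[N --> \oo] --> 0%E].

(* K is the universal constant that replaces log log n when the latter is less
   than one. Since p >= 2, taking K > 1/2 keeps log (p * loglog n) positive. *)
Definition loglog (R : realType) (K : R) (n : nat) : R :=
  if 1 <= ln (ln n%:R : R) then ln (ln n%:R) else K.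

Definition tau_sparse_sq (R : realType) (K : R) (p s n : nat) (alpha : R) : R :=
  let l := ln (p%:R * loglog K n) in
  s%:R * l / n%:R +
  s%:R * (n%:R / Num.sqrt l) `^ (- (4%:R * alpha / (4%:R * alpha + 1))).

Definition tau_sparse (R : realType) (K : R) (p s n : nat) (alpha : R) : R :=
  Num.sqrt (tau_sparse_sq K p s n alpha).

Definition alternative (R : realType) (psi : nat -> measurableTypeR R -> R)
    (K c : R) (p s n : nat) (alpha : R) : set (L2cube R p) :=
  [set f | signals psi s alpha f /\
           ((c * tau_sparse K p s n alpha)%:E <= norm2 f)%E].

Definition testing_risk (R : realType) (psi : nat -> measurableTypeR R -> R)
    (K c delta alpha0 alpha1 : R) (p n : nat) (d : measure_display)
    (Omega : measurableType d) (P : probability Omega R)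
    (W : L2cube R p -> {RV P >-> measurableTypeR R})
    (phi : {mfun observation R p >-> bool}) : \bar R :=
  (law W n 0%R [set y | phi y != false] +
   ereal_sup [set ereal_sup [set ereal_sup
      [set law W n f [set y | phi y != true]
      | f in alternative psi K c s n alpha]
      | alpha in [set a : R | (alpha0 <= a <= alpha1)%R]]
      | s in [set s : nat |
          (1 <= s)%N /\ (s%:R < p%:R `^ (2%:R^-1 - delta) :> R)%R]])%E.

(* Main.v *)
Require Import Defs.
From HB Require Import structures.
From mathcomp Require Import all_boot all_order all_algebra.
From mathcomp Require Import all_classical all_reals all_analysis.
From mathcomp Require Import ring lra zify.
From mathcomp Require Import measurable_realfun.

Set Implicit Arguments.
Unset Strict Implicit.
Unset Printing Implicit Defensive.
Import Order.TTheory GRing.Theory Num.Theory.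
Import numFieldNormedType.Exports.

Local Open Scope classical_set_scope.
Local Open Scope ring_scope.

(** The lower bound is the second moment method for a mixture of signals that
    all have one active coordinate, which is allowed for every sparsity level
    at least one.

    If signals [f i] are indexed by a finite set [I] and their average
    likelihood ratio with respect to pure noise has second moment at most
    [1 + eta ^ 2], no test can separate pure noise from all of them with total
    error below [1 - eta] ([second_moment_testing]). The second moment is
    explicit: it is the average over pairs of [exp (n <f i, f j>)]
    ([expectation_likelihoodM]). This rests on the Cameron-Martin formula
    ([cameron_martin]) on the whole observation space: the noise splits into
    its integral against [f] and an independent residual, shifting the mean by
    [f] moves only the former, and a shift of a one-dimensional Gaussian law has
    an explicit density.

    The signals are indexed by a coordinate [j < p], a level [m < M] and a
    vector of random signs. The signal at level [m] is
    [a m * sum_(k in block m) +-psi_k (x_j)], where the blocks are disjoint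
    ranges [N m <= k < 2 N m] of frequencies, so that different pairs [(j, m)]
    give orthogonal signals. Averaging over the signs of one pair turns the
    exponential into [cosh (n a ^ 2) ^ N], and the mixture is indistinguishable
    from noise as soon as this is at most [1 + eta ^ 2 p M]
    ([testing_risk_ge]).

    With [l = log (p loglog n)] and [a ^ 2 N = c ^ 2 tau ^ 2], either one
    frequency ([parametric_level]) or about [(n / sqrt l) ^ (2 / (4 alpha + 1))]
    frequencies ([nonparametric_level]) make the signal smooth enough and give
    [cosh (n a ^ 2) ^ N <= exp (2 c ^ 2 l) = (p loglog n) ^ (2 c ^ 2)]. By
    convexity this exceeds [1] by at most [2 c ^ 2 p loglog n]. If [loglog n] is
    at most of the order of [p], the [p] coordinates absorb [l] up to a factor
    two and one smoothness suffices ([one_level]). Otherwise [p] is so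
    small compared to [n] that the rate is nonparametric for every smoothness,
    and the dyadic block sizes realised by smoothnesses in
    [[alpha0, alpha1]], of which there are of order [log n], supply the more
    than [loglog n] levels that are needed ([many_levels]). *)

(** * Independence from linear combinations *)

(** In [B], both sides are finite measures with the same total mass. *)
Lemma indep_sigma_algebra {R : realType} {d : measure_display}
    {T : measurableType d} (P : probability T R) (A : set T) (G : set (set T)) :
  measurable A -> G `<=` measurable -> setI_closed G ->
  (forall B, G B -> P (A `&` B) = P A * P B)%E ->
  forall B, <<s G>> B -> (P (A `&` B) = P A * P B)%E.
Proof.
move=> mA Gm GI GA B sB.
have PA : P A = (fine (P A))%:E by rewrite fineK// fin_num_measure.
have PA0 : 0 <= fine (P A) by exact: fine_ge0.
pose m1 := mrestr P mA; pose m2 := mscale (NngNum PA0) P.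
have m2E C : m2 C = (P A * P C)%E by rewrite /m2 /mscale/= -PA.
have HG : [set X | G X /\ X `<=` setT] = G.
  by apply/seteqP; split=> [X []//|X GX]; split.
have m12T : m1 setT = m2 setT.
  by rewrite m2E probability_setT mule1 /m1 /mrestr setTI.
have := @g_sigma_algebra_measure_unique_trace _ _ _ G setT measurableT.
rewrite HG => /(_ R Gm GI m1 m2 m12T) H.
have : m1 B = m2 B.
  apply: H => //.
  - by move=> C GC; rewrite [RHS]m2E -GA// setIC.
  - by rewrite [X in (X < _)%E]m12T [X in (X < _)%E]m2E probability_setT mule1 (le_lt_trans (probability_le1 _ _)) ?ltry.
by rewrite [RHS]m2E -[LHS]/(P (B `&` A)) setIC.
Qed.

Section LinearCombinations.
Context {R : realType} {d : measure_display} {Omega : measurableType d}.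
Context (P : probability Omega R) {m : nat}.
Variable X : 'I_m.+1 -> {RV P >-> measurableTypeR R}.
Hypothesis X_indep : independent X.

Let boxes : set (set Omega) :=
  [set B | exists A : 'I_m -> set (measurableTypeR R),
    (forall i, measurable (A i)) /\
    B = \bigcap_i (X (lift ord0 i) @^-1` A i)].

Let boxes_measurable : boxes `<=` measurable.
Proof.
move=> _ [A [mA ->]]; apply: fin_bigcap_measurable => // i _.
by rewrite -[_ @^-1` _]setTI; exact: measurable_funPT.
Qed.

Let boxesI : setI_closed boxes.
Proof.
move=> _ _ [A [mA ->]] [B [mB ->]].
exists (fun i => A i `&` B i); split=> [i|]; first exact: measurableI.
by rewrite -bigcapI.
Qed.

Let boxes_indep A B : measurable A -> boxes B ->
  (P (X ord0 @^-1` A `&` B) = P (X ord0 @^-1` A) * P B)%E.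
Proof.
move=> mA [C [mC ->]].
pose E (A : set (measurableTypeR R)) i := oapp C A (unlift ord0 i).
have E0 D : E D ord0 = D by rewrite /E unlift_none.
have El D i : E D (lift ord0 i) = C i by rewrite /E liftK.
have mE D : measurable D -> forall i, measurable (E D i).
  move=> mD i; rewrite /E; case: (unlift ord0 i) => [j|]; [exact: mC|exact: mD].
have split D : \bigcap_i (X i @^-1` E D i) =
    X ord0 @^-1` D `&` \bigcap_i (X (lift ord0 i) @^-1` C i).
  apply/seteqP; split=> [w Ew|w [wD wC] i _].
    by split=> [|i _]; [have := Ew ord0 I|have := Ew (lift ord0 i) I];
      rewrite /= ?E0 ?El.
  have [j ->|->] := unliftP ord0 i; rewrite /= ?E0 ?El//.
  exact: (wC j I).
have prod D : measurable D -> P (X ord0 @^-1` D `&`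
      \bigcap_i (X (lift ord0 i) @^-1` C i)) =
    (P (X ord0 @^-1` D) * \prod_(i < m) P (X (lift ord0 i) @^-1` C i))%E.
  move=> mD; rewrite -split X_indep; last exact: mE.
  by rewrite big_ord_recl E0; congr (_ * _)%E; apply: eq_bigr => i _; rewrite El.
rewrite prod//; congr (_ * _)%E.
by have := prod setT measurableT; rewrite preimage_setT setTI probability_setT mul1e.
Qed.

(** The combinations are measurable for the sigma-algebra generated by the
    boxes, which form a pi-system. *)
Lemma indep_linear_combinations k (c : 'I_k -> 'I_m -> R)
    (A : set (measurableTypeR R)) (D : 'I_k -> set (measurableTypeR R)) :
  measurable A -> (forall l, measurable (D l)) ->
  let E := \bigcap_l [set w | D l (\sum_(i < m) c l i * X (lift ord0 i) w)] in
  (P (X ord0 @^-1` A `&` E) = P (X ord0 @^-1` A) * P E)%E.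
Proof.
move=> mA mD E; apply: (indep_sigma_algebra _ boxes_measurable boxesI).
- by rewrite -[_ @^-1` _]setTI; exact: measurable_funPT.
- by move=> B; exact: boxes_indep.
have mX i : measurable_fun setT
    (fun w : g_sigma_algebraType boxes => X (lift ord0 i) w : measurableTypeR R).
  move=> _ B mB; rewrite setTI; apply: sub_sigma_algebra.
  exists (fun j => if j == i then B else setT); split=> [j|].
    by case: ifP.
  apply/seteqP; split=> [w Bw j _/=|w /(_ i I)]; last by rewrite /= eqxx.
  by case: eqP => // ->.
suff : measurable (E : set (g_sigma_algebraType boxes)) by [].
apply: fin_bigcap_measurable => // l _.
have mV : measurable_fun setT (fun w : g_sigma_algebraType boxes =>
    \sum_(i < m) c l i * X (lift ord0 i) w : measurableTypeR R).
  by apply: measurable_sum => i; apply: measurable_funM => //; exact: mX.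
by have := mV measurableT _ (mD l); rewrite setTI.
Qed.

End LinearCombinations.

(** * The inner product *)

Section InnerProduct.
Context {R : realType} {p : nat}.
Implicit Types f g h : L2cube R p.

Lemma integrable_inner f g :
  (cube R p).-integrable setT (EFin \o (fun x => f x * g x)).
Proof. by apply/Lfun1_integrable/Lfun2_mul_Lfun1; exact: LfunP. Qed.

Lemma innerC f g : inner f g = inner g f.
Proof. by rewrite /inner; apply: eq_Rintegral => x _; rewrite mulrC. Qed.

Lemma innerDl f g h : inner (f + g) h = inner f h + inner g h.
Proof.
rewrite /inner -RintegralD//; [|exact: integrable_inner|exact: integrable_inner].
by apply: eq_Rintegral => x _; rewrite -mulrDl.
Qed.

Lemma innerZl a f h : inner (a *: f) h = a * inner f h.
Proof.
rewrite /inner -RintegralZl//; last exact: integrable_inner.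
by apply: eq_Rintegral => x _; rewrite mulrA.
Qed.

Lemma inner0l h : inner 0 h = 0.
Proof. by rewrite -(scale0r 0) innerZl mul0r. Qed.

Lemma innerDr f g h : inner h (f + g) = inner h f + inner h g.
Proof. by rewrite innerC innerDl !(innerC h). Qed.

Lemma innerZr a f h : inner h (a *: f) = a * inner h f.
Proof. by rewrite innerC innerZl innerC. Qed.

Lemma inner_suml (I : Type) (r : seq I) (P : pred I) (F : I -> L2cube R p) h :
  inner (\sum_(i <- r | P i) F i) h = \sum_(i <- r | P i) inner (F i) h.
Proof.
apply: (big_ind2 (fun u v => inner u h = v)) => //; first exact: inner0l.
by move=> u1 v1 u2 v2 <- <-; rewrite innerDl.
Qed.

Lemma inner_sumr (I : Type) (r : seq I) (P : pred I) (F : I -> L2cube R p) h :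
  inner h (\sum_(i <- r | P i) F i) = \sum_(i <- r | P i) inner h (F i).
Proof. by rewrite innerC inner_suml; apply: eq_bigr => i _; rewrite innerC. Qed.

Lemma inner_ge0 f : 0 <= inner f f.
Proof. by apply: Rintegral_ge0 => x _; rewrite -expr2 sqr_ge0. Qed.

(** Otherwise the squared norm of [g + t f] would be a nonconstant affine
    function of [t], and negative somewhere. *)
Lemma inner_degenerate f g : inner f f = 0 -> inner g f = 0.
Proof.
move=> ff0; pose b := inner g f; have q (t : R) : 0 <= inner g g + t * (b *+ 2).
  have := inner_ge0 (g + t *: f).
  rewrite innerDl !innerDr innerZl !innerZr innerZl ff0 !mulr0 addr0.
  by rewrite (innerC f) -/b -addrA mulr2n mulrDr.
apply/eqP/negPn/negP => b0.
have := q (- (inner g g + 1) / (b *+ 2)).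
by rewrite divfK ?mulrn_eq0//= opprD addNKr oppr_ge0 ler10.
Qed.

Lemma norm2_inner f : norm2 f = (Num.sqrt (inner f f))%:E.
Proof.
rewrite /norm2 unlock /inner.
under eq_integral => x _.
  rewrite /= -[2%:R]/(2%:R : R) powR_mulrn ?normr_ge0// real_normK ?num_real// expr2.
  over.
have := inner_ge0 f; rewrite /inner /Rintegral.
have := integrable_fin_num measurableT (integrable_inner f f).
rewrite /comp/=; move: (integral _ _ _) => [r _ /= r0|//|//].
by congr EFin; rewrite -powR12_sqrt.
Qed.

(** The family starts at [f], so that all its other members are orthogonal to
    [f]. Degenerate directions are harmless, since division by zero is zero and
    a vector of zero norm is orthogonal to everything. *)
Lemma gram_schmidt f (g : nat -> L2cube R p) k :
  exists h : nat -> L2cube R p, h 0 = f /\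
    (forall i j, (i < j <= k)%N -> inner (h i) (h j) = 0) /\
    forall l, (l < k)%N -> exists c : nat -> R, g l = \sum_(i < k.+1) c i *: h i.
Proof.
elim: k => [|k [h [h0 [ho hs]]]].
  by exists (fun=> f); split=> //; split=> [i j|//]; rewrite leqn0 andbC; case: eqP => // ->.
pose d i := inner (g k) (h i) / inner (h i) (h i).
pose e := g k - \sum_(i < k.+1) d i *: h i.
pose h' i := if (i <= k)%N then h i else e.
have hh' (c : nat -> R) : \sum_(i < k.+1) c i *: h i = \sum_(i < k.+1) c i *: h' i.
  by apply: eq_bigr => i _; rewrite /h' -ltnS ltn_ord.
have orth i : (i <= k)%N -> inner (h i) e = 0.
  move=> ik; rewrite /e innerDr -scaleN1r innerZr mulN1r inner_sumr.
  have ik1 : (i < k.+1)%N by [].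
  rewrite (bigD1 (Ordinal ik1))//= big1 ?addr0; last first.
    move=> j /eqP ji; rewrite innerZr.
    have {ji} : i != j by apply/eqP => ij; apply: ji; apply: val_inj.
    rewrite neq_ltn => /orP[ij|ij]; first by rewrite ho ?mulr0// ij -ltnS ltn_ord.
    by rewrite innerC ho ?mulr0// ij.
  rewrite innerZr /d; have [hi0|hi0] := eqVneq (inner (h i) (h i)) 0.
    by rewrite hi0 mulr0 subr0 innerC inner_degenerate.
  by rewrite divfK// innerC subrr.
exists h'; split; first by rewrite /h'.
split=> [i j /andP[ij]|l].
  rewrite leq_eqVlt => /predU1P[jk|].
    by subst j; rewrite /h' ltnn -ltnS ij orth.
  rewrite ltnS => jk.
  by rewrite /h' jk (leq_trans (ltnW ij) jk) ho// ij jk.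
rewrite ltnS leq_eqVlt => /predU1P[->|lk].
  exists (fun i => if (i <= k)%N then d i else 1).
  rewrite big_ord_recr/= ltnn scale1r.
  under eq_bigr => i _ do rewrite -ltnS ltn_ord.
  by rewrite -hh' /h' ltnn /e addrC subrK.
have [c ->] := hs l lk; exists (fun i => if (i <= k)%N then c i else 0).
rewrite [RHS]big_ord_recr/= ltnn scale0r addr0 hh'.
by apply: eq_bigr => i _; rewrite -ltnS ltn_ord.
Qed.

End InnerProduct.

(** * Shifts of Gaussian measures *)

Section Density.
Context {R : realType} {d : measure_display} {T : measurableType d}.
Variables (mu nu : {measure set T -> \bar R}) (h : T -> R).
Hypotheses (mh : measurable_fun setT h) (h0 : forall x, 0 <= h x).
Hypothesis nuE : forall A, measurable A -> nu A = (\int[mu]_(x in A) (h x)%:E)%E.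

Let density_indic A : measurable A ->
  (\int[nu]_x (\1_A x)%:E = \int[mu]_x ((\1_A x)%:E * (h x)%:E))%E.
Proof.
move=> mA; rewrite integral_indic// setIT nuE// [LHS]integral_mkcond.
apply: eq_integral => x _; rewrite patchE indicE.
by case: ifP; rewrite ?mul1e ?mul0e.
Qed.

Import HBNNSimple.

Let density_nnsfun (f : {nnsfun T >-> R}) :
  (\int[nu]_x (f x)%:E = \int[mu]_x ((f x)%:E * (h x)%:E))%E.
Proof.
under [LHS]eq_integral do rewrite fimfunE -fsumEFin//.
rewrite [LHS]ge0_integral_fsum//; last 2 first.
  - by move=> r; exact/measurable_EFinP/measurableT_comp.
  - by move=> n x _; rewrite EFinM nnfun_muleindic_ge0.
under [RHS]eq_integral.
  move=> x _; rewrite fimfunE -fsumEFin// muleC ge0_mule_fsumr; last first.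
    by move=> r; rewrite EFinM nnfun_muleindic_ge0.
  over.
rewrite [RHS]ge0_integral_fsum//; last 2 first.
  - move=> r; apply: emeasurable_funM; first exact/measurable_EFinP.
    exact/measurable_EFinP/measurableT_comp.
  - by move=> r x _; apply: mule_ge0; [rewrite lee_fin|rewrite EFinM nnfun_muleindic_ge0].
apply: eq_fsbigr => r /set_mem [x _ <-].
under eq_integral do rewrite EFinM.
under [RHS]eq_integral do rewrite EFinM muleCA [X in (_ * X)%E]muleC.
rewrite !ge0_integralZl ?lee_fin//; first by rewrite density_indic.
- by apply: emeasurable_funM; [exact/measurable_EFinP/measurable_indic|exact/measurable_EFinP].
- by move=> y _; rewrite mule_ge0 ?lee_fin ?h0.
- exact/measurable_EFinP/measurable_indic.
Qed.

(** Both sides are additive in [f] and continuous along increasing sequences, and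
    for indicators the identity is the definition of the density. *)
Lemma ge0_integral_density (f : T -> \bar R) :
  measurable_fun setT f -> (forall x, 0 <= f x)%E ->
  (\int[nu]_x f x = \int[mu]_x (f x * (h x)%:E))%E.
Proof.
move=> mf f0; pose f_ := nnsfun_approx measurableT mf.
have f_cvg x : (f_ n x)%:E @[n --> \oo] --> f x by exact: cvg_nnsfun_approx.
have f_nd x : {homo (fun n => f_ n x) : a b / (a <= b)%N >-> a <= b}.
  by move=> a b ab; exact/lefP/nd_nnsfun_approx.
transitivity (limn (fun n => \int[nu]_x (f_ n x)%:E)%E).
  rewrite -monotone_convergence//=.
  - by apply: eq_integral => x _; apply/esym/cvg_lim.
  - by move=> n; exact/measurable_EFinP.
  - by move=> n ? _; rewrite lee_fin.
  - by move=> x _ a b ab; rewrite lee_fin f_nd.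
under eq_fun do rewrite density_nnsfun.
rewrite -monotone_convergence//=.
- apply: eq_integral => x _; apply/cvg_lim => //.
  by rewrite muleC; under eq_fun do rewrite muleC; apply: cvgeZl.
- by move=> n; apply: emeasurable_funM; exact/measurable_EFinP.
- by move=> n x _; rewrite mule_ge0 ?lee_fin.
- by move=> x _ a b ab; rewrite lee_wpmul2r ?lee_fin ?f_nd.
Qed.

End Density.

Section GaussianShift.
Context {R : realType}.
Local Notation mu := (@lebesgue_measure R).

(** Lebesgue measure is determined by its values on half-open intervals. *)
Lemma ge0_integral_lebesgue_shift (a : R) (f : measurableTypeR R -> \bar R) :
  measurable_fun setT f -> (forall x, 0 <= f x)%E ->
  (\int[mu]_x f (x + a)%R = \int[mu]_x f x)%E.
Proof.
move=> mf f0.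
pose s : measurableTypeR R -> measurableTypeR R := fun x => x + a.
have ms : measurable_fun setT s by exact: measurable_funD.
pose sh : {mfun measurableTypeR R >-> measurableTypeR R} := mfun_Sub (mem_set ms).
transitivity (\int[pushforward mu sh]_x f x)%E.
  by rewrite ge0_integral_pushforward.
apply: eq_measure_integral => A mA _; apply/esym/lebesgue_measure_unique => //.
move=> _ [[x y] /= xy <-]; rewrite /pushforward.
have -> : sh @^-1` `]x, y]%classic = `]x - a, y - a]%classic.
  by apply/seteqP; split => z /=; rewrite !in_itv/= ltrBlDr lerBrDr.
rewrite !lebesgue_measure_itv/= !lte_fin ltrD2r; case: ifP => // _; rewrite -!EFinB; congr EFin; ring.
Qed.

(** Translating the variable of integration replaces the density at [x] by the
    density at [x - a s ^ 2]; the exponential is their quotient. *)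
Lemma gaussian_shift (s a : R) (f : measurableTypeR R -> \bar R) :
  s != 0 -> measurable_fun setT f -> (forall x, 0 <= f x)%E ->
  (\int[normal_prob 0 s]_x f (x + a * s ^+ 2)%R =
   \int[normal_prob 0 s]_x (f x * (expR (a * x - a ^+ 2 * s ^+ 2 / 2)%R)%:E))%E.
Proof.
move=> s0 mf f0.
have dens := @ge0_integral_density _ _ _ mu (normal_prob 0 s) (normal_pdf 0 s)
  (measurable_normal_pdf 0 s) (normal_pdf_ge0 0 s) (fun A _ => erefl).
have mshift : measurable_fun setT (fun x : measurableTypeR R => x + a * s ^+ 2).
  exact: measurable_funD.
rewrite dens//; last exact: measurableT_comp.
rewrite dens; last 2 first.
- apply: emeasurable_funM => //; apply/measurable_EFinP/measurableT_comp => //.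
  by apply: measurable_funB => //; exact: measurable_funM.
- by move=> x; rewrite mule_ge0// lee_fin expR_ge0.
rewrite -[RHS](ge0_integral_lebesgue_shift (a * s ^+ 2)); last 2 first.
- apply: emeasurable_funM.
    apply: emeasurable_funM => //; apply/measurable_EFinP/measurableT_comp => //.
    by apply: measurable_funB => //; exact: measurable_funM.
  by apply/measurable_EFinP; exact: measurable_normal_pdf.
- by move=> x; rewrite !mule_ge0 ?lee_fin ?expR_ge0 ?normal_pdf_ge0.
apply: eq_integral => x _; rewrite -muleA; congr (_ * _)%E.
rewrite -EFinM !normal_pdfE// mulrCA /normal_fun -expRD; congr (_ * expR _)%:E.
rewrite !subr0 -[s ^+ 2 *+ 2]mulr_natr; field.
by rewrite s0.
Qed.

End GaussianShift.

(** * The noise orthogonal to a direction *)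

Lemma ae_measure_eq {R : realType} {d : measure_display} {T : measurableType d}
    (mu : {measure set T -> \bar R}) (A B : set T) :
  measurable A -> measurable B -> {ae mu, forall x, A x <-> B x} -> mu A = mu B.
Proof.
move=> mA mB AB; rewrite -(setIT A) -(setIT B) -!integral_indic//.
apply: ae_eq_integral => //.
- exact/measurable_EFinP/measurable_indic.
- exact/measurable_EFinP/measurable_indic.
apply: filterS AB => x ABx _; congr (_%:E); rewrite !indicE; congr ((nat_of_bool _)%:R).
by apply/idP/idP => /set_mem /ABx ?; exact/mem_set.
Qed.

Section WhiteNoise.
Context {R : realType} {p : nat} {d : measure_display} {Omega : measurableType d}.
Context {P : probability Omega R}.
Variable W : L2cube R p -> {RV P >-> measurableTypeR R}.
Hypothesis HW : white_noise W.

Lemma measurable_observation {d' : measure_display} {T : measurableType d'}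
    (F : T -> observation R p) :
  (forall g, measurable_fun setT (fun t => F t g : measurableTypeR R)) ->
  measurable_fun setT F.
Proof.
move=> mF; have H := @measurability _ _ _ _ setT F (@cylinder R p). apply: H => //.
move=> _ [_ [g [A [mA ->]]] <-]; exact: mF.
Qed.

Lemma measurable_coordinate (g : L2cube R p) :
  measurable_fun setT (fun y : observation R p => y g : measurableTypeR R).
Proof.
move=> _ A mA; rewrite setTI; apply: sub_sigma_algebra.
by exists g, A.
Qed.

Let measurable_noise (g : L2cube R p) : measurable_fun setT (W g : Omega -> R).
Proof. exact: (@measurable_funPT _ _ _ _ (W g)). Qed.

Lemma ae_white_noise0 : {ae P, forall w, W 0 w = 0}.
Proof.
have := white_noise_linear HW 1 0 0; rewrite scaler0 addr0.
by apply: filterS => w; rewrite mul1r -[LHS]addr0 => /addrI.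
Qed.

Lemma ae_white_noise_sum (h : nat -> L2cube R p) (c : nat -> R) k :
  {ae P, forall w, W (\sum_(i < k) c i *: h i) w = \sum_(i < k) c i * W (h i) w}.
Proof.
elim: k => [|k ih].
  by rewrite big_ord0; apply: filterS ae_white_noise0 => w ->; rewrite big_ord0.
rewrite big_ord_recr/= addrC.
apply: (filterS2 _ _ ih (white_noise_linear HW (c k) (h k) (\sum_(i < k) c i *: h i))) => w {}ih ->.
by rewrite ih big_ord_recr/= addrC.
Qed.

Variable f : L2cube R p.
Hypothesis f_neq0 : inner f f != 0.

(** The part of the noise that is orthogonal to [f]. It is linear in [g] only
    almost surely, but it is defined everywhere, so that it is a map into the
    observation space. *)
Definition residual_noise (w : Omega) : observation R p :=
  fun g => W g w - inner f g / inner f f * W f w.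

Lemma measurable_residual_noise : measurable_fun setT residual_noise.
Proof.
apply: measurable_observation => g.
apply: measurable_funB; first exact: measurable_noise.
by apply: measurable_funM => //; exact: measurable_noise.
Qed.

Let residual_boxes : set (set Omega) :=
  [set B | exists k (g : nat -> L2cube R p) (D : nat -> set (measurableTypeR R)),
    (forall l, measurable (D l)) /\
    B = [set w | forall l, (l < k)%N -> D l (residual_noise w (g l))]].

Let residual_boxes_bigcap k (g : nat -> L2cube R p) (D : nat -> set (measurableTypeR R)) :
  [set w | forall l, (l < k)%N -> D l (residual_noise w (g l))] =
  \bigcap_(l in [set: 'I_k]) [set w | D l (residual_noise w (g l))].
Proof.
apply/seteqP; split=> w Dw; first by move=> l _; exact: Dw.
by move=> l lk; exact: (Dw (Ordinal lk)).
Qed.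

Let residual_boxes_measurable : residual_boxes `<=` measurable.
Proof.
move=> _ [k [g [D [mD ->]]]]; rewrite residual_boxes_bigcap.
apply: fin_bigcap_measurable => // l _.
have := measurableT_comp (measurable_coordinate (g l)) measurable_residual_noise.
by move=> /(_ measurableT _ (mD l)); rewrite setTI.
Qed.

Let residual_boxesI : setI_closed residual_boxes.
Proof.
move=> _ _ [k [g [D [mD ->]]]] [k' [g' [D' [mD' ->]]]].
exists (k + k')%N, (fun l => if (l < k)%N then g l else g' (l - k)%N).
exists (fun l => if (l < k)%N then D l else D' (l - k)%N).
split=> [l|]; first by case: ifP.
apply/seteqP; split=> [w [Dw Dw'] l lkk|w Dw].
  case: ifPn => [|]; first exact: Dw.
  by rewrite -leqNgt => kl; apply: Dw'; rewrite ltn_subLR.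
split=> l lk.
  by have := Dw l; rewrite lk; apply; rewrite ltn_addr.
by have := Dw (k + l)%N; rewrite [(k + l < k)%N]ltnNge leq_addr/= addKn ltn_add2l; apply.
Qed.

(** Gram-Schmidt expresses the residual integrals through integrals of
    functions orthogonal to [f] and to each other. *)
Let residual_boxes_indep A B0 : measurable A -> residual_boxes B0 ->
  (P (W f @^-1` A `&` B0) = P (W f @^-1` A) * P B0)%E.
Proof.
move=> mA [k [g [D [mD ->]]]].
have [h [h0 [ho hs]]] := gram_schmidt f g k.
have /choice[c hc] : forall l : 'I_k, exists c : nat -> R,
    g l = \sum_(i < k.+1) c i *: h i by move=> l; exact: hs.
pose X (i : 'I_k.+1) := W (h i).
have X_indep : independent X.
  apply: (white_noise_indep HW) => i j; rewrite neq_ltn => /orP[ij|ij].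
    by rewrite ho// ij -ltnS ltn_ord.
  by rewrite innerC ho// ij -ltnS ltn_ord.
have := indep_linear_combinations X_indep (fun l i => c l i.+1) mA
  (fun l : 'I_k => mD l).
rewrite /= /X/= h0; set E := \bigcap_l _ => PE.
set B := [set w | _].
have mB : measurable B by apply: residual_boxes_measurable; exists k, g, D.
have mWA : measurable (W f @^-1` A).
  by rewrite -[_ @^-1` _]setTI; exact: measurable_funPT.
have mE : measurable E.
  apply: fin_bigcap_measurable => // l _.
  have mV : measurable_fun setT (fun w : Omega =>
      \sum_(i < k) c l i.+1 * W (h i.+1) w : measurableTypeR R).
    by apply: measurable_sum => i; apply: measurable_funM => //; exact: measurable_noise.
  by have := mV measurableT _ (mD l); rewrite setTI.
have aeBE : {ae P, forall w, B w <-> E w}.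
  have ae_l (l : 'I_k) : {ae P, forall w, residual_noise w (g l) =
      \sum_(i < k) c l i.+1 * W (h i.+1) w}.
    have fg : inner f (g l) = c l 0 * inner f f.
      rewrite hc inner_sumr big_ord_recl/= innerZr h0 big1 ?addr0// => i _.
      by rewrite innerZr -h0 ho ?mulr0//= lift0 ltnS leq0n ltn_ord.
    have := ae_white_noise_sum h (c l) k.+1; rewrite -hc.
    apply: filterS => w; rewrite /residual_noise fg mulfK// => ->.
    by rewrite big_ord_recl/= h0 addrAC subrr add0r.
  have /filter_forall : forall l : 'I_k, {ae P, forall w, residual_noise w (g l) =
      \sum_(i < k) c l i.+1 * W (h i.+1) w} by [].
  apply: filterS => w rw; split=> [Bw l _|Ew l lk].
    by rewrite /= -rw; exact: Bw.
  by have := Ew (Ordinal lk) I; rewrite /= -rw.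
rewrite (ae_measure_eq mB mE aeBE) -PE; apply: ae_measure_eq.
- exact: measurableI.
- exact: measurableI.
by apply: filterS aeBE => w BE; split=> -[? /BE].
Qed.

Lemma residual_noise_indep A C : measurable A -> measurable C ->
  (P (W f @^-1` A `&` residual_noise @^-1` C) =
   P (W f @^-1` A) * P (residual_noise @^-1` C))%E.
Proof.
move=> mA mC.
apply: (indep_sigma_algebra _ residual_boxes_measurable residual_boxesI).
- by rewrite -[_ @^-1` _]setTI; exact: measurable_funPT.
- by move=> B; exact: residual_boxes_indep.
have mres : measurable_fun setT
    (residual_noise : g_sigma_algebraType residual_boxes -> observation R p).
  apply: measurable_observation => g _ D mD; rewrite setTI.
  apply: sub_sigma_algebra; exists 1, (fun=> g), (fun=> D); split=> //.
  by apply/seteqP; split=> w Dw //=; exact: (Dw 0).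
by have := mres measurableT _ mC; rewrite setTI.
Qed.

End WhiteNoise.

(** * The Cameron-Martin formula *)

Section CameronMartin.
Context {R : realType} {p : nat} {d : measure_display} {Omega : measurableType d}.
Context {P : probability Omega R}.
Variable W : L2cube R p -> {RV P >-> measurableTypeR R}.
Hypothesis HW : white_noise W.
Variable n : nat.
Hypothesis n_gt0 : (0 < n)%N.

Definition likelihood (f : L2cube R p) (w : Omega) : R :=
  expR (Num.sqrt n%:R * W f w - n%:R * inner f f / 2).

Lemma likelihood_ge0 f w : 0 <= likelihood f w. Proof. exact: expR_ge0. Qed.

Lemma measurable_likelihood f : measurable_fun setT (likelihood f).
Proof.
apply: measurableT_comp => //; apply: measurable_funB => //.
by apply: measurable_funM => //; exact: (@measurable_funPT _ _ _ _ (W f)).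
Qed.

Lemma measurable_observe f : measurable_fun setT (observe W n f).
Proof.
apply: measurable_observation => g; apply: measurable_funD => //.
by apply: measurable_funM => //; exact: (@measurable_funPT _ _ _ _ (W g)).
Qed.

Let sqrtn_neq0 : Num.sqrt (n%:R : R) != 0.
Proof. by rewrite gt_eqF// sqrtr_gt0 ltr0n. Qed.

Section nondegenerate.
Variable f : L2cube R p.
Hypothesis f_neq0 : inner f f != 0.

Let v := inner f f.
Let s := Num.sqrt v.

Let s2 : s ^+ 2 = v. Proof. by rewrite sqr_sqrtr// inner_ge0. Qed.

Let s_neq0 : s != 0.
Proof. by rewrite gt_eqF// sqrtr_gt0 lt_neqAle eq_sym f_neq0 inner_ge0. Qed.

(** The observations without and with signal are one and the same function of
    the residual and of a real number, which is [W f] without signal and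
    [W f + sqrt n |f| ^ 2] with signal. *)
Let recombine (z : observation R p * measurableTypeR R) : observation R p :=
  fun g => (z.1 g + inner f g / v * z.2) / Num.sqrt n%:R.

Let measurable_recombine : measurable_fun setT recombine.
Proof.
apply: measurable_observation => g; apply: measurable_funM => //.
apply: measurable_funD.
  exact: (measurableT_comp (measurable_coordinate g) measurable_fst).
by apply: measurable_funM.
Qed.

Let observe0E w : observe W n 0 w = recombine (residual_noise W f w, W f w).
Proof. by apply/funext => g; rewrite /observe inner0l add0r /recombine/= subrK. Qed.

Let observeE w : observe W n f w =
  recombine (residual_noise W f w, W f w + Num.sqrt n%:R * s ^+ 2).
Proof.
apply/funext => g; rewrite /observe /recombine/= /residual_noise s2 -/v.
by field; rewrite /v sqrtn_neq0 f_neq0.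
Qed.

Let residualRV : {RV P >-> observation R p} :=
  mfun_Sub (mem_set (measurable_residual_noise W f)).

Let measurable_joint : measurable_fun setT
  (fun w => (residual_noise W f w, W f w) : observation R p * measurableTypeR R).
Proof.
apply: measurable_fun_pair; first exact: measurable_residual_noise.
exact: (@measurable_funPT _ _ _ _ (W f)).
Qed.

Let jointRV : {RV P >-> (observation R p * measurableTypeR R)%type} :=
  mfun_Sub (mem_set measurable_joint).

(** The residual and [W f] are independent, and [W f] is Gaussian. *)
Let jointE F : measurable_fun setT F -> (forall z, 0 <= F z)%E ->
  (\int[P]_w F (residual_noise W f w, W f w) =
   \int[distribution P residualRV]_r \int[normal_prob 0 s]_u F (r, u))%E.
Proof.
move=> mF F0.
transitivity (\int[distribution P jointRV]_z F z)%E.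
  by rewrite ge0_integral_distribution.
transitivity (\int[distribution P residualRV \x distribution P (W f)]_z F z)%E.
  apply: eq_measure_integral => A mA _; apply/esym/product_measure_unique => //.
  move=> B D mB mD; rewrite muleC.
  rewrite -[RHS](residual_noise_indep HW f_neq0 mD mB) setIC.
  by [].
rewrite fubini_tonelli1//.
apply: eq_integral => r _; apply: eq_measure_integral => A mA _.
apply: (eq_trans (white_noise_law HW f mA)).
by rewrite /centered_gaussian (negbTE f_neq0).
Qed.

(** Given the residual, this is the shift of a one-dimensional Gaussian law. *)
Lemma cameron_martin_nondegenerate C : measurable C ->
  law W n f C =
  (\int[P]_w ((\1_(observe W n 0 @^-1` C) w)%:E * (likelihood f w)%:E))%E.
Proof.
move=> mC.
pose F (z : observation R p * measurableTypeR R) : \bar R := (\1_C (recombine z))%:E.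
have mF : measurable_fun setT F.
  by apply/measurable_EFinP; apply: measurableT_comp => //; exact: measurable_indic.
have F0 z : (0 <= F z)%E by rewrite lee_fin.
pose a : R := Num.sqrt n%:R.
pose shift (z : observation R p * measurableTypeR R) :
  observation R p * measurableTypeR R := (z.1, z.2 + a * s ^+ 2).
have mshift : measurable_fun setT shift.
  apply: measurable_fun_pair; first exact: measurable_fst.
  apply: measurable_funD => //.
pose L (z : observation R p * measurableTypeR R) : R :=
  expR (a * z.2 - a ^+ 2 * s ^+ 2 / 2).
have mL : measurable_fun setT L.
  apply: measurableT_comp => //; apply: measurable_funB => //.
  apply: measurable_funM => //.
transitivity (\int[P]_w F (shift (residual_noise W f w, W f w)))%E.
  rewrite /law /pushforward -(setIT (_ @^-1` _)) -integral_indic//; last first.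
    by rewrite -[_ @^-1` _]setTI; exact: measurable_observe.
  by apply: eq_integral => w _; rewrite /F /shift/= -observeE.
rewrite (jointE (F := F \o shift)); last 2 first.
- exact: measurableT_comp.
- by move=> z; exact: F0.
transitivity (\int[P]_w (F (residual_noise W f w, W f w) *
    (L (residual_noise W f w, W f w))%:E))%E; last first.
  apply: eq_integral => w _; rewrite /F -observe0E /L /likelihood /=.
  by rewrite s2 sqr_sqrtr.
rewrite (jointE (F := fun z => (F z * (L z)%:E)%E)); last 2 first.
- by apply: emeasurable_funM => //; exact/measurable_EFinP.
- by move=> z; rewrite mule_ge0// lee_fin expR_ge0.
apply: eq_integral => r _; apply: (gaussian_shift a (f := fun u => F (r, u))) => //.
by apply: (measurableT_comp mF); exact: measurable_pair1.
Qed.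

End nondegenerate.

(** An integrand of zero norm shifts nothing and is almost surely integrated to
    zero, so that the formula also holds for it. *)
Lemma cameron_martin f C : measurable C ->
  law W n f C =
  (\int[P]_w ((\1_(observe W n 0 @^-1` C) w)%:E * (likelihood f w)%:E))%E.
Proof.
have [ff0|] := eqVneq (inner f f) 0; last by move=> ff mC; exact: cameron_martin_nondegenerate.
move=> mC; have obs : observe W n f = observe W n 0.
  apply/funext => w; apply/funext => g.
  by rewrite /observe inner0l innerC inner_degenerate.
have mobs : measurable (observe W n 0 @^-1` C).
  by rewrite -[_ @^-1` _]setTI; exact: measurable_observe.
have mN0 : measurable ([set~ 0] : set (measurableTypeR R)).
  exact: measurableC.
have Wf0 : {ae P, forall w, W f w = 0}.
  exists (W f @^-1` [set~ 0]); split.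
  - by rewrite -[_ @^-1` _]setTI; exact: (@measurable_funPT _ _ _ _ (W f)).
  - apply: (eq_trans (white_noise_law HW f mN0)).
    by rewrite /centered_gaussian ff0 eqxx diracE memNset//=; apply.
  - by [].
rewrite /law obs /pushforward -(setIT (_ @^-1` _)) -integral_indic//.
apply: ae_eq_integral => //.
- exact/measurable_EFinP/measurable_indic.
- rewrite setIT; apply: emeasurable_funM; first exact/measurable_EFinP/measurable_indic.
  exact/measurable_EFinP/measurable_likelihood.
apply: filterS Wf0 => w Wf0 _.
by rewrite setIT /likelihood Wf0 ff0 !mulr0 mul0r subrr expR0 mule1.
Qed.

Lemma expectation_likelihood f :
  (\int[P]_w (likelihood f w)%:E = 1)%E.
Proof.
have := cameron_martin f measurableT; rewrite /law /pushforward preimage_setT.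
rewrite probability_setT => ->; apply: eq_integral => w _.
by rewrite preimage_setT indicT mul1e.
Qed.

(** The exponential [exp (sqrt n W f + sqrt n W g)] is the likelihood of
    [f + g] up to a constant. *)
Lemma expectation_likelihoodM f g :
  (\int[P]_w (likelihood f w * likelihood g w)%:E = (expR (n%:R * inner f g))%:E)%E.
Proof.
transitivity (\int[P]_w ((expR (n%:R * inner f g))%:E * (likelihood (f + g) w)%:E))%E.
  apply: ae_eq_integral => //.
  - by apply/measurable_EFinP/measurable_funM; exact: measurable_likelihood.
  - apply: emeasurable_funM => //; exact/measurable_EFinP/measurable_likelihood.
  have := white_noise_linear HW 1 f g; rewrite scale1r.
  apply: filterS => w Wfg _; rewrite -EFinM; congr EFin.
  rewrite /likelihood Wfg -!expRD innerDl !innerDr (innerC g f); congr expR.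
  by field.
rewrite ge0_integralZl//; last 2 first.
- exact/measurable_EFinP/measurable_likelihood.
- by move=> w _; rewrite lee_fin likelihood_ge0.
by rewrite expectation_likelihood mule1.
Qed.

End CameronMartin.

(** * The second moment method *)

Section SecondMoment.
Context {R : realType} {p : nat} {d : measure_display} {Omega : measurableType d}.
Context {P : probability Omega R}.
Variable W : L2cube R p -> {RV P >-> measurableTypeR R}.
Hypothesis HW : white_noise W.
Variable n : nat.
Hypothesis n_gt0 : (0 < n)%N.

Lemma law0_compl C : measurable C ->
  law W n 0%R (~` C) = (1 - P (observe W n 0%R @^-1` C))%E.
Proof.
move=> mC; rewrite /law /pushforward -preimage_setC probability_setC//.
by rewrite -[_ @^-1` _]setTI; exact: measurable_observe.
Qed.

Variables (I : finType) (f : I -> L2cube R p) (b : R).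
Hypotheses (I_gt0 : (0 < #|I|)%N) (b_gt0 : 0 < b).
Hypothesis second_moment :
  \sum_(i : I) \sum_(j : I) expR (n%:R * inner (f i) (f j)) <=
    (1 + b ^+ 2) * #|I|%:R ^+ 2.

Let N : R := #|I|%:R.
Let N_gt0 : 0 < N. Proof. by rewrite ltr0n. Qed.
Let mixture w : R := \sum_(i : I) likelihood W n (f i) w / N.

Let measurable_mixture : measurable_fun setT mixture.
Proof.
apply: measurable_sum => i; apply: measurable_funM => //.
exact: measurable_likelihood.
Qed.

Let mixture_ge0 w : 0 <= mixture w.
Proof. by apply: sumr_ge0 => i _; rewrite divr_ge0 ?likelihood_ge0 ?ltW. Qed.

Let expectation_mixture : (\int[P]_w (mixture w)%:E = 1)%E.
Proof.
under eq_integral do rewrite -sumEFin.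
rewrite ge0_integral_sum//; last 2 first.
- move=> i; apply/measurable_EFinP/measurable_funM => //.
  exact: measurable_likelihood.
- by move=> i w _; rewrite lee_fin divr_ge0 ?likelihood_ge0 ?ltW.
under eq_bigr => i _.
  under eq_integral do rewrite EFinM.
  rewrite ge0_integralZr//; last 3 first.
  - exact/measurable_EFinP/measurable_likelihood.
  - by move=> w _; rewrite lee_fin likelihood_ge0.
  - by rewrite lee_fin invr_ge0 ltW.
  rewrite (expectation_likelihood HW n_gt0) mul1e.
  over.
by rewrite sumEFin sumr_const -mulr_natl mulfV// gt_eqF.
Qed.

Let expectation_mixture_sqr :
  (\int[P]_w (mixture w ^+ 2)%:E <= (1 + b ^+ 2)%:E)%E.
Proof.
have -> : (\int[P]_w (mixture w ^+ 2)%:E = \sum_(i : I) \sum_(j : I)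
    \int[P]_w (likelihood W n (f i) w * likelihood W n (f j) w / N ^+ 2)%:E)%E.
  under eq_integral => w _.
    have -> : mixture w ^+ 2 = \sum_(i : I) \sum_(j : I)
        likelihood W n (f i) w * likelihood W n (f j) w / N ^+ 2.
      rewrite expr2 /mixture big_distrlr/=; apply: eq_bigr => i _.
      by apply: eq_bigr => j _; rewrite mulrACA expr2 invfM.
    rewrite -sumEFin.
    under eq_bigr do rewrite -sumEFin.
    over.
  have mL i j : measurable_fun setT (fun w =>
      (likelihood W n (f i) w * likelihood W n (f j) w / N ^+ 2)%:E).
    apply/measurable_EFinP/measurable_funM => //.
    by apply: measurable_funM; exact: measurable_likelihood.
  have L0 i j w : (0 <= (likelihood W n (f i) w * likelihood W n (f j) w / N ^+ 2)%:E)%E.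
    by rewrite lee_fin divr_ge0 ?mulr_ge0 ?likelihood_ge0 ?sqr_ge0.
  rewrite ge0_integral_sum//; last 2 first.
  - by move=> i; apply: emeasurable_sum.
  - by move=> i w _; apply: sume_ge0.
  by apply: eq_bigr => i _; rewrite ge0_integral_sum.
under eq_bigr => i _.
  under eq_bigr => j _.
    under eq_integral do rewrite EFinM.
    rewrite ge0_integralZr//; last 3 first.
    - by apply/measurable_EFinP/measurable_funM; exact: measurable_likelihood.
    - by move=> w _; rewrite lee_fin mulr_ge0 ?likelihood_ge0.
    - by rewrite lee_fin invr_ge0 sqr_ge0.
    rewrite (expectation_likelihoodM HW n_gt0) -EFinM.
    over.
  rewrite sumEFin -mulr_suml.
  over.
by rewrite sumEFin -mulr_suml lee_fin ler_pdivrMr ?exprn_gt0.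
Qed.

(** The difference of the two sides is a square, or a sum of two squares, over
    [2 b]. Written with nonnegative terms only, it replaces the Cauchy-Schwarz
    inequality for the integral of [1_A (1 - L)]. *)
Let le_indicator (x : bool) (L : R) : 0 <= L ->
  x%:R + L / b <= x%:R * L + (b / 2 + ((2 * b)^-1 + L ^+ 2 / (2 * b))).
Proof.
move=> L0; rewrite -subr_ge0.
case: x; rewrite ?mul1r ?mul0r.
  have -> : true%:R = 1 :> R by [].
  have -> : L + (b / 2 + ((2 * b)^-1 + L ^+ 2 / (2 * b))) - (1 + L / b) =
      (b + L - 1) ^+ 2 / (2 * b) by field; rewrite gt_eqF.
  by rewrite divr_ge0 ?sqr_ge0// mulr_ge0// ltW.
have -> : false%:R = 0 :> R by [].
have -> : 0 + (b / 2 + ((2 * b)^-1 + L ^+ 2 / (2 * b))) - (0 + L / b) =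
  (b ^+ 2 + (1 - L) ^+ 2) / (2 * b) by field; rewrite gt_eqF.
by rewrite divr_ge0 ?addr_ge0 ?sqr_ge0// mulr_ge0// ltW.
Qed.

(** As the mixture has mean [1] and second moment at most [1 + b ^ 2], the bound
    above integrates to [P A + 1 / b <= E (1_A L) + b + 1 / b]. *)
Let null_le_mixture C : measurable C ->
  (P (observe W n 0%R @^-1` C) <=
   (\sum_(i : I) fine (law W n (f i) C) / N)%:E + b%:E)%E.
Proof.
move=> mC; set A := observe W n 0%R @^-1` C.
have mA : measurable A by rewrite -[A]setTI; exact: measurable_observe.
have m1A : measurable_fun setT (\1_A : Omega -> R) by exact: measurable_indic.
have mixE : (\int[P]_w (\1_A w * mixture w)%:E =
    (\sum_(i : I) fine (law W n (f i) C) / N)%:E)%E.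
  under eq_integral do rewrite mulr_sumr -sumEFin.
  rewrite ge0_integral_sum//; last 2 first.
  - move=> i; apply/measurable_EFinP/measurable_funM => //.
    by apply: measurable_funM => //; exact: measurable_likelihood.
  - by move=> i w _; rewrite lee_fin mulr_ge0// divr_ge0 ?likelihood_ge0 ?ltW.
  rewrite -sumEFin; apply: eq_bigr => i _.
  rewrite EFinM fineK; last first.
    by rewrite fin_num_measure// -[_ @^-1` _]setTI; exact: measurable_observe.
  rewrite (cameron_martin HW n_gt0)// -ge0_integralZr//; last 3 first.
  - by apply: emeasurable_funM; apply/measurable_EFinP => //; exact: measurable_likelihood.
  - by move=> w _; rewrite mule_ge0// lee_fin likelihood_ge0.
  - by rewrite lee_fin invr_ge0 ltW.
  by apply: eq_integral => w _; rewrite -!EFinM mulrA.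
have key : (\int[P]_w ((\1_A w)%:E + (mixture w / b)%:E) <=
    \int[P]_w ((\1_A w * mixture w)%:E +
      ((b / 2)%:E + ((2 * b)^-1%:E + (mixture w ^+ 2 / (2 * b))%:E))))%E.
  apply: ge0_le_integral => //.
  - by move=> w _; rewrite adde_ge0// lee_fin// divr_ge0// ltW.
  - by apply: emeasurable_funD; apply/measurable_EFinP => //; exact: measurable_funM.
  - apply: emeasurable_funD; first exact/measurable_EFinP/measurable_funM.
    apply: emeasurable_funD => //; apply: emeasurable_funD => //.
    by apply/measurable_EFinP/measurable_funM => //; exact: measurable_funX.
  - by move=> w _; rewrite -!EFinD lee_fin indicE le_indicator.
have b20 : 0 <= (2 * b)^-1 by rewrite invr_ge0 mulr_ge0// ltW.
have mm2 : measurable_fun setT (fun w => (mixture w ^+ 2 / (2 * b))%:E).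
  by apply/measurable_EFinP/measurable_funM => //; exact: measurable_funX.
have m20 w : (0 <= (mixture w ^+ 2 / (2 * b))%:E)%E.
  by rewrite lee_fin mulr_ge0// sqr_ge0.
have mb : measurable_fun setT (fun w => (mixture w / b)%:E).
  exact/measurable_EFinP/measurable_funM.
have b0 w : (0 <= (mixture w / b)%:E)%E by rewrite lee_fin divr_ge0// ltW.
rewrite ge0_integralD// in key; last exact/measurable_EFinP.
rewrite integral_indic// setIT in key.
rewrite [X in (_ + X <= _)%E](_ : _ = b^-1%:E)%E in key; last first.
  under eq_integral do rewrite EFinM.
  rewrite ge0_integralZr//; first by rewrite expectation_mixture mul1e.
  - exact/measurable_EFinP.
  - by move=> w _; rewrite lee_fin.
  - by rewrite lee_fin invr_ge0 ltW.
rewrite [leRHS]ge0_integralD// in key; last 4 first.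
- by move=> w _; rewrite lee_fin mulr_ge0.
- exact/measurable_EFinP/measurable_funM.
- by move=> w _; rewrite !adde_ge0// lee_fin// divr_ge0// ltW.
- by apply: emeasurable_funD => //; exact: emeasurable_funD.
rewrite mixE in key.
rewrite ge0_integralD// in key; last 3 first.
- by move=> w _; rewrite lee_fin divr_ge0// ltW.
- by move=> w _; rewrite adde_ge0// lee_fin.
- exact: emeasurable_funD.
rewrite ge0_integralD// in key.
rewrite !integral_cst//= !probability_setT !mule1 in key.
set q := \sum_(i : I) _ in key *.
have sqr_le : (\int[P]_w (mixture w ^+ 2 / (2 * b))%:E <=
    ((1 + b ^+ 2) / (2 * b))%:E)%E.
  under eq_integral do rewrite EFinM.
  rewrite ge0_integralZr//; last 2 first.
  - by apply/measurable_EFinP; exact: measurable_funX.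
  - by move=> w _; rewrite lee_fin sqr_ge0.
  by rewrite EFinM lee_wpmul2r// lee_fin.
have PA : P A = (fine (P A))%:E by rewrite fineK// fin_num_measure.
have : (P A + b^-1%:E <= q%:E + ((b / 2)%:E + ((2 * b)^-1%:E +
    ((1 + b ^+ 2) / (2 * b))%:E)))%E.
  by apply: (le_trans key); rewrite !leeD2l.
rewrite PA -!EFinD !lee_fin => {}key.
rewrite -(lerD2r b^-1); apply: (le_trans key).
rewrite le_eqVlt; apply/orP; left; apply/eqP; field; by rewrite gt_eqF.
Qed.

(** The inequality holds on average over [i]. *)
Lemma second_moment_testing (phi : {mfun observation R p >-> bool}) :
  exists i : I, ((1 - b)%:E <= law W n 0%R [set y | phi y != false] +
                            law W n (f i) [set y | phi y != true])%E.
Proof.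
set C := [set y | phi y != true].
have mC : measurable C.
  rewrite (_ : C = setT `&` phi @^-1` [set false]).
    exact: measurable_funPT.
  by apply/seteqP; split=> y; rewrite /C /=; case: (phi y) => // -[].
have -> : [set y | phi y != false] = ~` C.
  by apply/seteqP; split=> y; rewrite /C /=; case: (phi y) => // /(_ isT).
rewrite law0_compl//.
have mobs g : measurable (observe W n g @^-1` C).
  by rewrite -[_ @^-1` _]setTI; exact: measurable_observe.
have lawE i : law W n (f i) C = (fine (law W n (f i) C))%:E.
  by rewrite fineK// fin_num_measure.
have PA : P (observe W n 0%R @^-1` C) = (fine (P (observe W n 0%R @^-1` C)))%:E.
  by rewrite fineK// fin_num_measure.
have := null_le_mixture mC; rewrite PA; set a := fine (P _).
rewrite -EFinD lee_fin => aq; apply: contrapT => /forallNP H.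
suff : \sum_(i : I) fine (law W n (f i) C) / N < a - b.
  by rewrite ltNge; apply/negP; rewrite negbK lerBlDr.
have lt_i i : fine (law W n (f i) C) < a - b.
  rewrite ltNge; apply/negP => ab; apply: (H i); rewrite lawE -EFinB -EFinD lee_fin.
  lra.
have [i0 _] : exists i0 : I, i0 \in I by apply/card_gt0P.
have -> : a - b = \sum_(i : I) (a - b) / N.
  by rewrite sumr_const -mulr_natl mulrCA mulfV ?mulr1// gt_eqF.
rewrite (bigD1 i0)//= [ltRHS](bigD1 i0)//= ltr_leD ?ltr_pM2r ?invr_gt0//.
by apply: ler_sum => i _; rewrite ler_wpM2r ?(ltW (lt_i i))// invr_ge0 ltW.
Qed.

End SecondMoment.

(** * An orthonormal system of additive functions *)

Section Coordinates.
Context {R : realType}.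
Local Notation mR := (measurableTypeR R).

Lemma cube_box p (A : 'I_p -> set mR) : (forall j, measurable (A j)) ->
  cube R p (\bigcap_j (fun x : p.-tuple mR => tnth x j) @^-1` A j) =
  (\prod_(j < p) leb01 R (A j))%E.
Proof.
elim: p A => [|p ih] A mA.
  rewrite big_ord0 /= (_ : \bigcap_j _ = setT); first by rewrite diracT.
  by apply/seteqP; split=> // x _ [].
rewrite big_ord_recl -ih// /= /distribution /pushforward.
rewrite (_ : _ @^-1` _ = A ord0 `*`
    \bigcap_j (fun x : p.-tuple mR => tnth x j) @^-1` A (lift ord0 j)).
  rewrite product_measure1E//; apply: fin_bigcap_measurable => // j _.
  by rewrite -[_ @^-1` _]setTI; exact: measurable_tnth.
apply/seteqP; split=> [[x y] /= xyA|[x y] /= [xA yA] j _].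
  split; first by have := xyA ord0 I.
  by move=> j _ /=; have := xyA (lift ord0 j) I; rewrite /= tnthS.
by have [k ->|->] := unliftP ord0 j; rewrite /= ?tnthS //; exact: yA.
Qed.

Lemma cube_coordinate p (j : 'I_p) (A : set mR) : measurable A ->
  cube R p ((fun x : p.-tuple mR => tnth x j) @^-1` A) = leb01 R A.
Proof.
move=> mA; pose B i := if i == j then A else setT.
have mB i : measurable (B i) by rewrite /B; case: ifP.
have -> : (fun x : p.-tuple mR => tnth x j) @^-1` A =
    \bigcap_i (fun x : p.-tuple mR => tnth x i) @^-1` B i.
  apply/seteqP; split=> [x xA i _|x /(_ j I)]; last by rewrite /B /= eqxx.
  by rewrite /B /=; case: eqP => // ->.
rewrite cube_box// (bigD1 j)//= /B eqxx big1 ?mule1// => i /negbTE ->.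
exact: probability_setT.
Qed.

Lemma cube_coordinate2 p (i j : 'I_p) (A B : set mR) : i != j ->
  measurable A -> measurable B ->
  cube R p ((fun x : p.-tuple mR => (tnth x i, tnth x j)) @^-1` (A `*` B)) =
  (leb01 R A * leb01 R B)%E.
Proof.
move=> ij mA mB; pose C k := if k == i then A else if k == j then B else setT.
have mC k : measurable (C k) by rewrite /C; case: ifP => // _; case: ifP.
have Ci : C i = A by rewrite /C eqxx.
have Cj : C j = B by rewrite /C eq_sym (negbTE ij) eqxx.
have -> : (fun x : p.-tuple mR => (tnth x i, tnth x j)) @^-1` (A `*` B) =
    \bigcap_k (fun x : p.-tuple mR => tnth x k) @^-1` C k.
  apply/seteqP; split=> [x [/= xA xB] k _|x xC].
    by rewrite /C /=; case: eqP => [->//|_]; case: eqP => [->//|].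
  by split; [have := xC i I|have := xC j I]; rewrite /= ?Ci ?Cj.
rewrite cube_box// (bigD1 i)//= (bigD1 j) 1?eq_sym//= Ci Cj big1 ?mule1// => k.
move=> /andP[/negbTE ki /negbTE kj]; rewrite /C ki kj; exact: probability_setT.
Qed.

End Coordinates.

Lemma integral_image {R : realType} {d d' : measure_display}
    {T : measurableType d} {T' : measurableType d'} (P : {measure set T -> \bar R})
    (nu : {measure set T' -> \bar R}) (X : T -> T') (F : T' -> \bar R) :
  measurable_fun setT X -> measurable_fun setT F ->
  (forall A, measurable A -> P (X @^-1` A) = nu A) ->
  P.-integrable setT (F \o X) ->
  nu.-integrable setT F /\ (\int[P]_x F (X x) = \int[nu]_y F y)%E.
Proof.
move=> mX mF PX intF.
pose X' : {mfun T >-> T'} := mfun_Sub (mem_set mX).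
have nuE A : measurable A -> A `<=` setT -> nu A = pushforward P X' A.
  by move=> mA _; rewrite -PX.
have int' := integrable_pushforward (D := setT) mX mF intF measurableT.
split.
  apply/integrableP; split => //.
  rewrite (eq_measure_integral (pushforward P X')) => [|A mA _]; last by rewrite -PX.
  by have /integrableP[] := int'.
rewrite (eq_measure_integral (pushforward P X')) => [|A mA _]; last by rewrite -PX.
by rewrite (integral_pushforward (D := setT) mX mF intF).
Qed.

Section AdditiveSystem.
Context {R : realType} (psi : nat -> measurableTypeR R -> R).
Hypothesis psi_on : orthonormal_centered psi.
Variable p : nat.

Let measurable_psi k : measurable_fun setT (psi k).
Proof. by have := psi_L2 psi_on k; rewrite inE => /andP[/[!inE]]. Qed.

Definition coordinate_wave k (j : 'I_p) (x : p.-tuple (measurableTypeR R)) : R :=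
  psi k (tnth x j).

Let measurable_wave k j : measurable_fun setT (coordinate_wave k j).
Proof. exact: (measurableT_comp (measurable_psi k) (measurable_tnth j)). Qed.

Lemma coordinate_wave_Lfun k j : coordinate_wave k j \in Lfun (cube R p) 2%:R%:E.
Proof.
rewrite inE; apply/andP; split; first by rewrite inE; exact: measurable_wave.
have := psi_L2 psi_on k; rewrite inE => /andP[_]; rewrite !inE/= /finite_norm.
rewrite unlock /=; apply: le_lt_trans; rewrite le_eqVlt; apply/orP; left; apply/eqP.
congr (_ `^ _)%E.
pose X : {mfun p.-tuple (measurableTypeR R) >-> measurableTypeR R} :=
  mfun_Sub (mem_set (measurable_tnth j)).
pose F (y : measurableTypeR R) := (`|(psi k y)%:E| `^ 2%:R)%E.
have mF : measurable_fun setT F.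
  by apply: (measurableT_comp (measurable_poweR _)); apply: measurableT_comp => //; exact/measurable_EFinP.
transitivity (\int[pushforward (cube R p) X]_y F y)%E.
  by rewrite ge0_integral_pushforward// => y _; exact: poweR_ge0.
by apply: eq_measure_integral => A mA _; exact: cube_coordinate.
Qed.

Definition wave k j : L2cube R p := Lfun_Sub (le1_2e R) (coordinate_wave_Lfun k j).

(** Two different coordinates are independent and each factor has mean zero; on
    one coordinate this is the orthonormality of [psi]. *)
Lemma wave_orthonormal k i l j :
  inner (wave k i) (wave l j) = ((k == l) && (i == j))%:R.
Proof.
have intw := integrable_inner (wave k i) (wave l j).
have [ij|ij] := eqVneq i j.
  rewrite -{j}ij in intw *.
  rewrite andbT -(psi_orthonormal psi_on); congr fine.
  pose F (y : measurableTypeR R) := (psi k y * psi l y)%:E.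
  have mF : measurable_fun setT F.
    by apply/measurable_EFinP; exact: measurable_funM.
  by have [] := integral_image (measurable_tnth i) mF (@cube_coordinate R p i) intw.
rewrite andbF.
pose F (y : measurableTypeR R * measurableTypeR R) := (psi k y.1 * psi l y.2)%:E.
have mF : measurable_fun setT F.
  apply/measurable_EFinP; apply: measurable_funM.
    exact: (measurableT_comp (measurable_psi k) measurable_fst).
  exact: (measurableT_comp (measurable_psi l) measurable_snd).
have mX : measurable_fun setT (fun x : p.-tuple (measurableTypeR R) =>
    (tnth x i, tnth x j)).
  by apply: measurable_fun_pair; exact: measurable_tnth.
have PX A : measurable A -> cube R p ((fun x => (tnth x i, tnth x j)) @^-1` A) =
    (leb01 R \x leb01 R)%E A.
  move=> mA; pose X : {mfun p.-tuple (measurableTypeR R) >->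
      (measurableTypeR R * measurableTypeR R)%type} := mfun_Sub (mem_set mX).
  apply/esym.
  have := @product_measure_unique _ _ _ _ R (leb01 R) (leb01 R) (distribution (cube R p) X).
  by apply => // B C mB mC; exact: cube_coordinate2.
have [intF FE] := integral_image mX mF PX intw.
transitivity (fine (\int[leb01 R \x leb01 R]_y F y)%E); first by rewrite -FE.
rewrite -integral12_prod_meas1//.
have intpsi m : (leb01 R).-integrable setT (EFin \o psi m).
  apply/Lfun1_integrable/Lfun_subset12; last exact: (psi_L2 psi_on).
  exact: fin_num_measure.
under eq_integral => x _.
  rewrite /fubini_F /F/=.
  under eq_integral do rewrite EFinM.
  rewrite integralZl//.
  have -> : (\int[leb01 R]_y (psi l y)%:E = 0)%E.
    rewrite -(fineK (integrable_fin_num measurableT (intpsi l))).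
    by congr EFin; exact: (psi_centered psi_on).
  rewrite mule0; over.
  exact: intpsi.
by rewrite integral0_eq.
Qed.

End AdditiveSystem.

(** * Signals with random signs on a block of frequencies *)

Section SparseSignals.
Context {R : realType} (psi : nat -> measurableTypeR R -> R).
Hypothesis psi_on : orthonormal_centered psi.
Variables (p D : nat).

Definition ridge (j : 'I_p) (t : 'I_D -> R) : L2cube R p :=
  \sum_(k < D) t k *: wave psi_on k j.

Lemma ridgeE j t x : ridge j t x = \sum_(k < D) t k * psi k (tnth x j).
Proof.
rewrite /ridge; apply: (big_ind2 (fun (u : L2cube R p) v => u x = v)) => //.
by move=> u1 v1 u2 v2 <- <-.
Qed.

Lemma inner_ridge i j t u :
  inner (ridge i t) (ridge j u) = (i == j)%:R * \sum_(k < D) t k * u k.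
Proof.
rewrite /ridge inner_suml mulr_sumr; apply: eq_bigr => k _.
rewrite innerZl inner_sumr (bigD1 k)//= innerZr wave_orthonormal eqxx/=.
rewrite big1 ?addr0; last first.
  move=> l lk; rewrite innerZr wave_orthonormal (_ : (k == l :> nat) = false) ?mulr0//.
  by apply/negbTE; rewrite eq_sym; exact: lk.
by rewrite mulrA mulrC.
Qed.

(** Only finitely many coefficients are nonzero, so that the partial sums of the
    series that defines a signal are eventually equal to it. *)
Lemma ridge_signal alpha j t :
  \sum_(k < D) t k ^+ 2 * k.+1%:R `^ (2 * alpha) <= 1 ->
  signals psi 1 alpha (ridge j t).
Proof.
move=> t1; pose c k := if insub k is Some i then t i else 0.
have cE (k : 'I_D) : c k = t k by rewrite /c valK.
have c0 k : (D <= k)%N -> c k = 0 by move=> Dk; rewrite /c insubF// ltnNge Dk.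
pose theta k i := if i == j then c k else 0.
exists theta.
  split.
    rewrite -(cards1 j); apply/subset_leq_card/fintype.subsetP => i.
    rewrite !inE => -[k]; rewrite /theta; case: (i == j) => //; by rewrite eqxx.

  move=> i; pose F k := theta k i ^+ 2 / k.+1%:R `^ (- (2%:R * alpha)).
  have F0 k : 0 <= F k by rewrite divr_ge0 ?sqr_ge0 ?powR_ge0.
  apply: lime_le; first by apply: is_cvg_nneseries => k _ _; rewrite lee_fin F0.
  exists D => // n /= Dn; rewrite sumEFin lee_fin.
  rewrite (@big_cat_nat _ _ _ D)//= [X in _ + X]big_nat_cond [X in _ + X]big1 ?addr0.
    rewrite big_mkord; apply: (le_trans _ t1); apply: ler_sum => k _.
    rewrite powRN invrK /theta cE; case: ifP => // _.
    by rewrite expr0n mul0r mulr_ge0 ?sqr_ge0 ?powR_ge0.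
  by move=> k /andP[/andP[Dk _] _]; rewrite /theta c0// if_same expr0n mul0r.
apply: cvg_near_cst; exists D => // n /= Dn.
rewrite (_ : (fun x => _) = cst 0%E) ?Lnorm0 ?eqe//.
apply/funext => x; rewrite (bigD1 j)//= [X in _ - (_ + X)]big1 ?addr0; last first.
  by move=> i /negbTE ij; rewrite big1// => k _; rewrite /theta ij mul0r.
suff -> : \sum_(k < n) theta k j * psi k (tnth x j) = ridge j t x by rewrite subrr.
rewrite ridgeE -(big_mkord xpredT (fun k => theta k j * psi k (tnth x j))).
rewrite (@big_cat_nat _ _ _ D)//= [X in _ + X]big_nat_cond [X in _ + X]big1 ?addr0.
  by rewrite big_mkord; apply: eq_bigr => k _; rewrite /theta eqxx cE.
by move=> k /andP[/andP[Dk _] _]; rewrite /theta c0// if_same mul0r.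
Qed.

End SparseSignals.

Section SignedBlocks.
Context {R : realType}.

Definition cosh (x : R) : R := (expR x + expR (- x)) / 2.

Definition sgn (b : bool) : R := if b then 1 else -1.

(** Index [k] stands for frequency [k + 1], and a block is the set of frequencies
    from [N] to [2 N - 1]. *)
Definition in_block (N k : nat) : bool := (N <= k.+1 < N.*2)%N.

Definition signed_block D (N : nat) (a : R) (sigma : {ffun 'I_D -> bool}) (k : 'I_D) : R :=
  if in_block N k then a * sgn (sigma k) else 0.

Lemma card_block D N : (0 < N)%N -> (N.*2 <= D)%N ->
  #|[pred k : 'I_D | in_block N k]| = N.
Proof.
move=> N0 ND; rewrite -sum1_card -(big_mkord (in_block N) (fun=> 1%N)).
rewrite (@big_cat_nat _ _ _ N.-1)//=; last by lia.
rewrite (@big_cat_nat _ _ _ (N.*2).-1 N.-1)/=; [|lia|lia].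
rewrite big_nat_cond big1 ?add0n; last by move=> k; rewrite /in_block; lia.
rewrite [X in (_ + X)%N]big_nat_cond [X in (_ + X)%N]big1 ?addn0; last first.
  by move=> k; rewrite /in_block; lia.
rewrite big_nat_cond (eq_bigl (fun k => (N.-1 <= k < (N.*2).-1)%N && true)); last first.
  by move=> k; rewrite /in_block; lia.
by rewrite -big_nat_cond sum_nat_const_nat; lia.
Qed.

Lemma sgn_sqr b : sgn b ^+ 2 = 1. Proof. by case: b; rewrite ?sqrrN expr1n. Qed.

Lemma sum_signed_block_sqr D N a (sigma : {ffun 'I_D -> bool}) (w : 'I_D -> R) :
  \sum_(k < D) signed_block N a sigma k ^+ 2 * w k =
  \sum_(k < D | in_block N k) a ^+ 2 * w k.
Proof.
rewrite [RHS]big_mkcond; apply: eq_bigr => k _; rewrite /signed_block.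
by case: ifP => _; rewrite ?expr0n ?mul0r// exprMn sgn_sqr mulr1.
Qed.

Lemma sum_signed_block_cross D N N' a a' (sigma sigma' : {ffun 'I_D -> bool}) :
  (forall k, in_block N k -> ~~ in_block N' k) ->
  \sum_(k < D) signed_block N a sigma k * signed_block N' a' sigma' k = 0.
Proof.
move=> NN'; apply: big1 => k _; rewrite /signed_block.
by case: ifP => [/NN'/negbTE ->|_]; rewrite ?mulr0 ?mul0r.
Qed.

(** Summing over the signs of one of the two blocks already makes the sum
    independent of the signs of the other. *)
Lemma sum_expR_signed_block D N a x : (0 < N)%N -> (N.*2 <= D)%N ->
  \sum_(sigma : {ffun 'I_D -> bool}) \sum_(sigma' : {ffun 'I_D -> bool})
    expR (x * \sum_(k < D) signed_block N a sigma k * signed_block N a sigma' k) =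
  cosh (x * a ^+ 2) ^+ N * #|{ffun 'I_D -> bool}|%:R ^+ 2.
Proof.
move=> N0 ND; pose y := x * a ^+ 2.
have ch sigma : \sum_(sigma' : {ffun 'I_D -> bool})
    expR (x * \sum_(k < D) signed_block N a sigma k * signed_block N a sigma' k) =
    cosh y ^+ N * 2 ^+ D.
  pose g (k : 'I_D) (b : bool) : R :=
    if in_block N k then expR (y * (sgn (sigma k) * sgn b)) else 1.
  under eq_bigr => sigma' _.
    rewrite mulr_sumr expR_sum (eq_bigr (fun k => g k (sigma' k))).
      over.
    move=> k _; rewrite /g /signed_block; case: ifP => _; last by rewrite mulr0 mulr0 expR0.
    by congr expR; rewrite /y; ring.
  rewrite -(bigA_distr_bigA g).
  transitivity (\prod_(k < D) ((if in_block N k then cosh y else 1) * 2)).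
    apply: eq_bigr => k _; rewrite big_bool/= /g; case: ifP => _; last by rewrite mul1r.
    rewrite /cosh divfK// /sgn; case: (sigma k); rewrite !mulr1 ?mulrN1 ?mulrN ?mulr1 ?opprK//.
    by rewrite addrC.
  rewrite big_split/= prodr_const card_ord; congr (_ * _).
  by rewrite -big_mkcond/= prodr_const card_block.
under eq_bigr do rewrite ch.
rewrite sumr_const card_ffun card_ord card_bool natrX -[LHS]mulr_natr natrX.
by rewrite -mulrA -expr2.
Qed.

End SignedBlocks.

(** * Lower bound on the risk from a family of levels *)

(** The pairs with equal first component are a fraction [1 / #|J|] of all pairs,
    which is why their average may exceed [1] by as much as [q #|J|]. *)
Lemma product_second_moment {R : realType} (J S : finType) (G : J -> S -> J -> S -> R)
    (q : R) :
  (forall u v s t, u != v -> G u s v t = 1) ->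
  (forall u, \sum_(s : S) \sum_(t : S) G u s u t <=
             (1 + q * #|J|%:R) * #|S|%:R ^+ 2) ->
  0 <= q ->
  \sum_(x : J * S) \sum_(y : J * S) G x.1 x.2 y.1 y.2 <=
    (1 + q) * #|{: J * S}|%:R ^+ 2.
Proof.
move=> Goff Gdiag q0.
have -> : \sum_(x : J * S) \sum_(y : J * S) G x.1 x.2 y.1 y.2 =
    \sum_(u : J) \sum_(v : J) \sum_(s : S) \sum_(t : S) G u s v t.
  rewrite -(pair_bigA _ (fun u s => \sum_(y : J * S) G u s y.1 y.2))/=.
  apply: eq_bigr => u _.
  under eq_bigr => s _ do rewrite -(pair_bigA _ (fun v t => G u s v t))/=.
  by rewrite exchange_big.
have row (u : J) : \sum_(v : J) \sum_(s : S) \sum_(t : S) G u s v t <=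
    (1 + q) * #|J|%:R * #|S|%:R ^+ 2.
  rewrite (bigD1 u)//=.
  have -> : \sum_(v | v != u) \sum_s \sum_t G u s v t =
      (#|J|%:R - 1) * #|S|%:R ^+ 2.
    under eq_bigr => v vu.
      rewrite (eq_bigr (fun=> #|S|%:R)); last first.
        move=> s _; rewrite (eq_bigr (fun=> 1)) ?sumr_const// => t _.
        by rewrite Goff// eq_sym.
      rewrite sumr_const; over.
    rewrite (sumr_const (predC1 u)) cardC1.
    have J0 : (0 < #|J|)%N by apply/card_gt0P; exists u.
    rewrite -!mulrnA !natrM -subn1 natrB// expr2.
    rewrite (_ : #|xpredT| = #|S|); last exact: eq_card.
    by ring.
  by apply: (le_trans (lerD (Gdiag u) (lexx _))); rewrite -mulrDl; lra.
apply: (le_trans (ler_sum _ (fun u _ => row u))).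
rewrite sumr_const card_prod natrM exprMn -mulr_natr.
by rewrite le_eqVlt; apply/orP; left; apply/eqP; ring.
Qed.

Section LowerBound.
Context {R : realType} (psi : nat -> measurableTypeR R -> R).
Hypothesis psi_on : orthonormal_centered psi.
Variables (K alpha0 alpha1 delta c b : R) (p n M : nat).
Hypotheses (p_ge2 : (2 <= p)%N) (n_gt0 : (0 < n)%N) (M_gt0 : (0 < M)%N).
Hypotheses (delta_lt : delta < 2%:R^-1) (c_gt0 : 0 < c) (b_gt0 : 0 < b).
Context {d : measure_display} {Omega : measurableType d} {P : probability Omega R}.
Variable W : L2cube R p -> {RV P >-> measurableTypeR R}.
Hypothesis HW : white_noise W.

Variables (N : 'I_M -> nat) (a alpha : 'I_M -> R).
Hypothesis N_gt0 : forall m, (0 < N m)%N.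
Hypothesis blocks_disjoint :
  forall m m', m != m' -> forall k, in_block (N m) k -> ~~ in_block (N m') k.
Hypothesis alpha_range : forall m, alpha0 <= alpha m <= alpha1.
Hypothesis alpha_ge0 : 0 <= alpha0.
Hypothesis separation : forall m,
  c ^+ 2 * tau_sparse_sq K p 1 n (alpha m) <= a m ^+ 2 * (N m)%:R.
Hypothesis smoothness : forall m,
  a m ^+ 2 * (N m)%:R * (2 * (N m)%:R) `^ (2 * alpha m) <= 1.
Hypothesis indistinguishable : forall m,
  cosh (n%:R * a m ^+ 2) ^+ N m <= 1 + b ^+ 2 * (p * M)%:R.

Let D := (\max_(m < M) (N m).*2)%N.
Let ND m : ((N m).*2 <= D)%N.
Proof. exact: (@leq_bigmax_cond _ xpredT (fun m => (N m).*2) m). Qed.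

Let signal (u : 'I_p * 'I_M) (sigma : {ffun 'I_D -> bool}) : L2cube R p :=
  ridge psi_on u.1 (signed_block (N u.2) (a u.2) sigma).

Let sum_block m (sigma : {ffun 'I_D -> bool}) :
  \sum_(k < D) signed_block (N m) (a m) sigma k ^+ 2 = a m ^+ 2 * (N m)%:R.
Proof.
under eq_bigr do rewrite -[_ ^+ 2]mulr1.
rewrite (sum_signed_block_sqr _ _ _ (fun=> 1)) mulr1.
by rewrite (sumr_const [pred k : 'I_D | in_block (N m) k]) card_block ?N_gt0 ?ND// mulr_natr.
Qed.

Let signal_alternative u sigma :
  alternative psi K c 1 n (alpha u.2) (signal u sigma).
Proof.
case: u => j m /=; split.
  apply: ridge_signal.
  rewrite (sum_signed_block_sqr _ _ _ (fun k => k.+1%:R `^ (2 * alpha m))).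
  apply: le_trans (smoothness m).
  apply: (@le_trans _ _ (\sum_(k < D | in_block (N m) k)
    a m ^+ 2 * (2 * (N m)%:R) `^ (2 * alpha m))).
    apply: ler_sum => k /andP[_ kN]; rewrite ler_wpM2l ?sqr_ge0//.
    have /andP[am _] := alpha_range m.
    apply: ge0_ler_powR; rewrite ?nnegrE ?mulr_ge0 ?ler0n ?(le_trans alpha_ge0)//.
    by rewrite -natrM ler_nat mul2n ltnW.
  rewrite (sumr_const [pred k : 'I_D | in_block (N m) k]) card_block ?N_gt0 ?ND// -[leLHS]mulr_natr.
  by rewrite mulrAC.
rewrite norm2_inner inner_ridge eqxx mul1r.
under eq_bigr do rewrite -expr2.
rewrite sum_block lee_fin /tau_sparse.
rewrite -[c](ger0_norm (ltW c_gt0)) -sqrtr_sqr -sqrtrM ?sqr_ge0//.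
exact: ler_wsqrtr.
Qed.

(** The mixture is uniform over coordinates, levels and sign vectors. Signals of
    different coordinates or levels are orthogonal, and for equal ones the
    average over signs is a power of [cosh]. *)
Lemma testing_risk_ge (phi : {mfun observation R p >-> bool}) :
  ((1 - b)%:E <= testing_risk psi K c delta alpha0 alpha1 n W phi)%E.
Proof.
pose f (x : 'I_p * 'I_M * {ffun 'I_D -> bool}) := signal x.1 x.2.
have p_gt0 : (0 < p)%N by rewrite (leq_trans _ p_ge2).
have card_gt0 : (0 < #|{: 'I_p * 'I_M * {ffun 'I_D -> bool}}|)%N.
  by rewrite !card_prod !card_ord card_ffun card_bool card_ord !muln_gt0 p_gt0 M_gt0 expn_gt0.
have moment : \sum_x \sum_y expR (n%:R * inner (f x) (f y)) <=
    (1 + b ^+ 2) * #|{: 'I_p * 'I_M * {ffun 'I_D -> bool}}|%:R ^+ 2.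
  apply: (product_second_moment
    (G := fun u s v t => expR (n%:R * inner (signal u s) (signal v t)))).
  - move=> u v s t uv; rewrite inner_ridge.
    have [uv1|] := eqVneq u.1 v.1; last by rewrite mul0r mulr0 expR0.
    rewrite sum_signed_block_cross ?mulr0 ?expR0//.
    apply: blocks_disjoint; apply: contraNneq uv => uv2.
    by case: u v uv1 uv2 => [? ?] [? ?] /= -> ->.
  - move=> u; under eq_bigr do under eq_bigr do rewrite inner_ridge eqxx mul1r.
    rewrite sum_expR_signed_block// ler_wpM2r ?sqr_ge0//.
    by rewrite card_prod !card_ord.
  - exact: sqr_ge0.
have [x] := second_moment_testing HW n_gt0 card_gt0 b_gt0 moment phi.
move=> H; apply: (le_trans H); rewrite /testing_risk leeD2l//.
apply: (@le_trans _ _ (ereal_sup [set ereal_sup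
      [set law W n f [set y | phi y != true]
      | f in alternative psi K c 1 n al]
      | al in [set al : R | (alpha0 <= al <= alpha1)%R]])); last first.
  apply: ereal_sup_ubound; exists 1 => //; split=> //.
  have p1 : 1 < p%:R :> R by rewrite ltr1n.
  by rewrite /powR gt_eqF ?(lt_trans ltr01)// expR_gt1 mulr_gt0 ?subr_gt0// ln_gt0.
apply: (@le_trans _ _ (ereal_sup [set law W n f [set y | phi y != true]
      | f in alternative psi K c 1 n (alpha x.1.2)])); last first.
  by apply: ereal_sup_ubound; exists (alpha x.1.2) => //=; exact: alpha_range.
by apply: ereal_sup_ubound; exists (f x) => //; exact: signal_alternative.
Qed.

End LowerBound.

(** * Calibration of a level *)

Section ElementaryBounds.
Context {R : realType}.
Implicit Types x y : R.

Lemma cosh_ge0 x : 0 <= cosh x.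
Proof. by rewrite divr_ge0// addr_ge0// expR_ge0. Qed.

Lemma cosh_le_expR x : 0 <= x -> cosh x <= expR x.
Proof.
move=> x0; rewrite /cosh ler_pdivrMr// mulr_natr mulr2n lerD2l ler_expR.
by rewrite ge0_cp.
Qed.

(** Near zero, [exp (- x) >= 1 - x] bounds both exponentials from above and
    their sum by [2 / (1 - x ^ 2)]; away from zero, [|x| <= 2 x ^ 2]. *)
Lemma cosh_le_gauss x : cosh x <= expR (2 * x ^+ 2).
Proof.
wlog x0 : x / 0 <= x => [H|].
  have [/H//|x0] := leP 0 x; have := H (- x).
  by rewrite sqrrN /cosh opprK addrC; apply; rewrite oppr_ge0 ltW.
have [xs|xl] := leP x 2^-1; last first.
  apply: (le_trans (cosh_le_expR x0)); rewrite ler_expR; nra.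
have e1 : expR x <= (1 - x)^-1.
  rewrite -[leLHS]invrK lef_pV2 ?posrE ?invr_gt0 ?expR_gt0//; last by lra.
  by rewrite -expRN expR_ge1Dx.
have e2 : expR (- x) <= (1 + x)^-1.
  rewrite expRN lef_pV2 ?posrE ?expR_gt0 ?expR_ge1Dx//; lra.
apply: (@le_trans _ _ (1 + 2 * x ^+ 2)); last exact: expR_ge1Dx.
apply: (@le_trans _ _ (((1 - x)^-1 + (1 + x)^-1) / 2)).
  by rewrite /cosh ler_pM2r ?invr_gt0// lerD.
have -> : ((1 - x)^-1 + (1 + x)^-1) / 2 = (1 - x ^+ 2)^-1.
  field; apply/and3P; split; apply/eqP; nra.
have x2 : 0 <= x ^+ 2 <= 4^-1 by apply/andP; split; nra.
move: (x ^+ 2) x2 => z /andP[z0 z4].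
by rewrite -[leLHS]mul1r ler_pdivrMr; nra.
Qed.

(** On the segment from [0] to [y], the exponential lies below its chord. *)
Lemma expR_le_chord (k y : R) : 0 <= k <= 1 -> expR (k * y) <= 1 + k * (expR y - 1).
Proof.
move=> k01; have := convex_expR (Itv01 (proj1 (andP k01)) (proj2 (andP k01))) y 0.
rewrite !convRE/= expR0 mulr0 addr0 mulr1 => H.
by apply: (le_trans H); rewrite /unstable.onem; lra.
Qed.

Lemma expR_ge_half_sqr y : 0 <= y -> y ^+ 2 / 2 <= expR y.
Proof.
move=> y0; apply: le_trans (expR_ge1Dxn 1 y0).
by rewrite (_ : 2`! = 2%N)//= lerDr.
Qed.

End ElementaryBounds.

Section Calibration.
Context {R : realType}.
Variables (n l alpha c : R).
Hypotheses (n_gt0 : 0 < n) (l_gt0 : 0 < l) (alpha_gt0 : 0 < alpha).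
Hypotheses (c_gt0 : 0 < c) (c_le : c <= 2^-1).

Let X := n / Num.sqrt l.
Let rate := X `^ (- (4 * alpha / (4 * alpha + 1))).
Let T := l / n + rate.

Let X_gt0 : 0 < X. Proof. by rewrite divr_gt0// sqrtr_gt0. Qed.
Let rate_gt0 : 0 < rate. Proof. exact: powR_gt0. Qed.
Let T_gt0 : 0 < T. Proof. by rewrite addr_gt0// divr_gt0. Qed.

(** When the term [l / n] dominates, a single frequency suffices: its squared
    amplitude is at most [2 c ^ 2 l / n], and [cosh] is at most [exp]. *)
Lemma parametric_level : rate <= l / n -> 2 * c ^+ 2 * (l / n * 2 `^ (2 * alpha)) <= 1 ->
  c ^+ 2 * T * (2 * 1) `^ (2 * alpha) <= 1 /\
  cosh (n * (c ^+ 2 * T / 1)) ^+ 1 <= expR (2 * c ^+ 2 * l).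
Proof.
move=> rl small; have Tl : T <= 2 * (l / n) by rewrite /T; lra.
split.
  apply: le_trans small; rewrite mulr1 [leRHS]mulrA ler_wpM2r ?powR_ge0//.
  by rewrite -mulrA [2 * _]mulrCA ler_wpM2l ?sqr_ge0.
rewrite expr1 divr1; apply: (le_trans (cosh_le_expR _)).
  by rewrite !mulr_ge0// ?sqr_ge0// ltW.
rewrite ler_expR mulrCA -mulrA [2 * _]mulrCA ler_wpM2l ?sqr_ge0//.
apply: (le_trans (ler_wpM2l (ltW n_gt0) Tl)).
by rewrite mulrCA [n * _]mulrCA mulfV ?mulr1// gt_eqF.
Qed.

(** When the rate dominates, the exponent of [X] is such that [N] squared
    amplitudes of size [rate / N] produce [n ^ 2 rate ^ 2 / N], of order [l]. *)
Lemma nonparametric_level (C : R) (N : nat) : l / n <= rate -> 1 <= C -> (0 < N)%N ->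
  X `^ (2 / (4 * alpha + 1)) <= N%:R -> N%:R <= C * X `^ (2 / (4 * alpha + 1)) ->
  2 * c ^+ 2 * (2 * C) `^ (2 * alpha) <= 1 ->
  c ^+ 2 * T * (2 * N%:R) `^ (2 * alpha) <= 1 /\
  cosh (n * (c ^+ 2 * T / N%:R)) ^+ N <= expR (2 * c ^+ 2 * l).
Proof.
move=> rl C1 N0 XN NX small; have TT : T <= 2 * rate by rewrite /T; lra.
have N0' : 0 < N%:R :> R by rewrite ltr0n.
have a1 : 4 * alpha + 1 != 0 by rewrite gt_eqF// ltr_wpDl// mulr_ge0// ltW.
set Y := X `^ _ in XN NX.
have Y0 : 0 < Y by exact: powR_gt0.
have rateY : rate * Y `^ (2 * alpha) = 1.
  rewrite /rate /Y -powRrM -powRD; last by rewrite (gt_eqF X_gt0) implybT.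
  rewrite (_ : _ + _ = 0) ?powRr0//; field.
  exact: a1.
split.
  apply: le_trans small.
  have H : (2 * N%:R) `^ (2 * alpha) <= (2 * C) `^ (2 * alpha) * Y `^ (2 * alpha).
    have C0 : 0 <= 2 * C by rewrite mulr_ge0// (le_trans ler01).
    rewrite -powRM//; last exact: ltW.
    apply: ge0_ler_powR; rewrite ?nnegrE.
    - by rewrite mulr_ge0// ltW.
    - by rewrite mulr_ge0// ler0n.
    - by rewrite mulr_ge0// ltW.
    - by rewrite -mulrA ler_wpM2l.
  apply: (le_trans (ler_pM _ _ (ler_wpM2l (sqr_ge0 c) TT) H)).
  - by rewrite mulr_ge0 ?sqr_ge0// ltW.
  - exact: powR_ge0.
  have -> : c ^+ 2 * (2 * rate) * ((2 * C) `^ (2 * alpha) * Y `^ (2 * alpha)) =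
      2 * c ^+ 2 * (2 * C) `^ (2 * alpha) * (rate * Y `^ (2 * alpha)) by ring.
  by rewrite rateY mulr1.
have nX : n ^+ 2 = X ^+ 2 * l.
  by rewrite /X expr_div_n sqr_sqrtr ?ltW// divfK// gt_eqF.
have rate2 : X ^+ 2 * rate ^+ 2 = Y.
  rewrite -!powR_mulrn ?ltW// /rate -powRrM -powRD; last by rewrite (gt_eqF X_gt0) implybT.
  by rewrite /Y; congr (_ `^ _); field.
apply: (@le_trans _ _ (expR (2 * (n * (c ^+ 2 * T / N%:R)) ^+ 2) ^+ N)).
  by rewrite lerXn2r ?nnegrE ?cosh_ge0 ?expR_ge0 ?cosh_le_gauss.
rewrite -expRM_natr ler_expR.
have TN : T ^+ 2 <= 4 * rate ^+ 2 by have := ltW T_gt0; have := ltW rate_gt0; nra.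
have -> : 2 * (n * (c ^+ 2 * T / N%:R)) ^+ 2 * N%:R =
    2 * c ^+ 4 * (n ^+ 2 * T ^+ 2) / N%:R by field; rewrite gt_eqF.
rewrite ler_pdivrMr//.
have H1 : n ^+ 2 * T ^+ 2 <= 4 * l * N%:R.
  apply: (le_trans (ler_wpM2l (sqr_ge0 n) TN)).
  have -> : n ^+ 2 * (4 * rate ^+ 2) = 4 * l * (X ^+ 2 * rate ^+ 2) by rewrite nX; ring.
  by rewrite rate2 ler_wpM2l// mulr_ge0// ltW.
have c2 : c ^+ 2 <= 4^-1 by have := c_gt0; have := c_le; nra.
have -> : 2 * c ^+ 4 * (n ^+ 2 * T ^+ 2) = 2 * c ^+ 2 * (c ^+ 2 * (n ^+ 2 * T ^+ 2)).
  by ring.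
have c20 : 0 <= 2 * c ^+ 2 by rewrite mulr_ge0// sqr_ge0.
rewrite -[leRHS]mulrA ler_wpM2l//.
apply: (le_trans (ler_wpM2l (sqr_ge0 c) H1)).
rewrite -[4 * l * _]mulrA; have : 0 <= l * N%:R by rewrite mulr_ge0 ?ltW.
move: (l * N%:R) (c ^+ 2) c2 (sqr_ge0 c) => z c' c2 c0 z0.
by rewrite mulrA ler_piMl//; lra.
Qed.

End Calibration.

(** * A single level *)

Section OneLevel.
Context {R : realType}.
Variables (K alpha0 alpha1 eta L0 c : R) (p n : nat).
Hypotheses (hK : 2^-1 < K) (alpha0_gt0 : 0 < alpha0) (alpha01 : alpha0 < alpha1).
Hypotheses (p_ge2 : (2 <= p)%N) (hpn : ln (1 + p%:R) <= n%:R / 2%:R :> R).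
Hypotheses (c_gt0 : 0 < c) (c_le : c <= 2^-1).

Let LL := loglog K n.
Let l : R := ln (p%:R * LL).

Lemma half_lt_loglog : 2^-1 < LL.
Proof.
rewrite /LL /loglog; case: ifP => // H; apply: lt_le_trans H.
by rewrite invf_lt1// ltr1n.
Qed.

Let LL_gt0 : 0 < LL. Proof. by apply: lt_trans half_lt_loglog; rewrite invr_gt0. Qed.

Let p_ge2R : 2 <= p%:R :> R. Proof. by rewrite ler_nat. Qed.
Let p_gt0 : 0 < p%:R :> R. Proof. exact: lt_le_trans p_ge2R. Qed.

Lemma log_gt0 : 0 < l.
Proof. by apply: ln_gt0; have := half_lt_loglog; have := p_ge2R; nra. Qed.

Lemma sample_gt0 : (0 < n)%N.
Proof.
rewrite lt0n; apply/eqP => n0; move: hpn; rewrite n0 mul0r leNgt => /negP; apply.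
by apply: ln_gt0; rewrite ltrDl.
Qed.

Let n_ge1 : 1 <= n%:R :> R. Proof. by rewrite ler1n sample_gt0. Qed.

Lemma loglog_le : LL <= K + n%:R.
Proof.
have K0 : 0 < K by apply: lt_trans hK; rewrite invr_gt0.
rewrite /LL /loglog; case: ifP => H; last by rewrite lerDl (le_trans ler01).
have lnn : 0 < ln (n%:R : R).
  by rewrite ltNge; apply/negP => lnn; move: H; rewrite (ln0 lnn) ler10.
apply: ltW; apply: (lt_trans (ln_sublinear lnn)).
have n0 : 0 < n%:R :> R by apply: lt_le_trans n_ge1.
by apply: (lt_trans (ln_sublinear n0)); rewrite ltrDr.
Qed.

Lemma log_le : l <= (K + 2) * n%:R.
Proof.
rewrite /l lnM ?posrE//.
have lnp : ln p%:R <= n%:R / 2 :> R.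
  by apply: le_trans hpn; rewrite ler_ln ?posrE// ?lerDr// addr_gt0.
have lnL : ln LL <= K + n%:R := le_trans (ltW (ln_sublinear LL_gt0)) loglog_le.
have := hK; have := n_ge1; nra.
Qed.

(** The squared norm [c ^ 2 T] is spread evenly over the [N] frequencies of a
    block. *)
Lemma amplitude (T : R) (N : nat) : 0 <= T -> (0 < N)%N ->
  exists a : R, a ^+ 2 = c ^+ 2 * T / N%:R /\ a ^+ 2 * N%:R = c ^+ 2 * T.
Proof.
move=> T0 N0; exists (Num.sqrt (c ^+ 2 * T / N%:R)).
rewrite sqr_sqrtr; last by rewrite divr_ge0// mulr_ge0// sqr_ge0.
by split=> //; rewrite divfK// pnatr_eq0 -lt0n.
Qed.

Hypotheses (L0_ge1 : 1 <= L0) (LL_le : LL <= Num.max p%:R L0).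
Hypothesis c_eta : 4 * c ^+ 2 * L0 <= eta ^+ 2.
Hypothesis c_smooth :
  2 * c ^+ 2 * ((K + 2) * (2 * (1 + (K + 2) ^+ 2)) `^ (2 * alpha1)) <= 1.

Let exp_le : expR (2 * c ^+ 2 * l) <= 1 + eta ^+ 2 * (p * 1)%:R.
Proof.
have pL0 : 0 < p%:R * L0 by rewrite mulr_gt0// (lt_le_trans ltr01).
have pL2 : p%:R * LL <= (p%:R * L0) ^+ 2.
  rewrite expr2 -mulrA ler_pM2l//.
  apply: (le_trans LL_le); rewrite ge_max; apply/andP; split.
    have := p_ge2R; have := L0_ge1; nra.
  have := p_ge2R; have := L0_ge1; nra.
have l_le : l <= 2 * ln (p%:R * L0).
  have pLL0 : 0 < p%:R * LL by exact: mulr_gt0.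
  by rewrite mulr_natl -lnXn// ler_ln// posrE; exact: exprn_gt0.
apply: (@le_trans _ _ (expR (4 * c ^+ 2 * ln (p%:R * L0)))).
  rewrite ler_expR; have := sqr_ge0 c; nra.
have k01 : 0 <= 4 * c ^+ 2 <= 1.
  by apply/andP; have := c_gt0; have := c_le; have := sqr_ge0 c; split; nra.
apply: (le_trans (expR_le_chord _ k01)); rewrite lnK ?posrE// muln1 lerD2l.
have := c_eta; have := sqr_ge0 c; have := p_gt0; nra.
Qed.

(** As [loglog n] is at most of the order of [p], the factor [exp (2 c ^ 2 l)] is
    at most [(p L0) ^ (4 c ^ 2)], which the [p] coordinates compensate. The
    bound [l <= (K + 2) n] controls the smoothness condition and keeps [X] away
    from zero, so that rounding its power up costs a bounded factor. *)
Lemma one_level : exists (N : nat) (a : R), (0 < N)%N /\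
  c ^+ 2 * tau_sparse_sq K p 1 n alpha0 <= a ^+ 2 * N%:R /\
  a ^+ 2 * N%:R * (2 * N%:R) `^ (2 * alpha0) <= 1 /\
  cosh (n%:R * a ^+ 2) ^+ N <= 1 + eta ^+ 2 * (p * 1)%:R.
Proof.
have n0 : 0 < n%:R :> R by apply: lt_le_trans n_ge1.
have l0 := log_gt0; have lB := log_le.
pose B := K + 2; pose C := 1 + B ^+ 2.
have B1 : 1 <= B by rewrite /B; have := hK; lra.
have C1 : 1 <= C by rewrite lerDl sqr_ge0.
pose X := n%:R / Num.sqrt l.
pose rate := X `^ (- (4 * alpha0 / (4 * alpha0 + 1))).
have X0 : 0 < X by rewrite divr_gt0// sqrtr_gt0.
have -> : tau_sparse_sq K p 1 n alpha0 = l / n%:R + rate.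
  by rewrite /tau_sparse_sq !mul1r.
have T0 : 0 <= l / n%:R + rate by rewrite addr_ge0 ?powR_ge0// divr_ge0// ltW.
have pow_le : (2 * C) `^ (2 * alpha0) <= (2 * C) `^ (2 * alpha1).
  by apply: ler_powR; [lra|have := alpha01; lra].
have c20 : 0 <= 2 * c ^+ 2 by rewrite mulr_ge0// sqr_ge0.
have [rl|/ltW rl] := leP rate (l / n%:R).
  have small : 2 * c ^+ 2 * (l / n%:R * 2 `^ (2 * alpha0)) <= 1.
    apply: le_trans c_smooth; rewrite ler_wpM2l//.
    apply: ler_pM; rewrite ?powR_ge0 ?divr_ge0 ?(ltW l0)//.
      by rewrite ler_pdivrMr.
    apply: (le_trans _ pow_le); apply: ge0_ler_powR; rewrite ?nnegrE.
    - by rewrite mulr_ge0// ltW.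
    - by [].
    - by rewrite mulr_ge0// (le_trans ler01).
    - by rewrite -[leLHS]mulr1 ler_wpM2l.
  have [smooth indist] := parametric_level n0 l0 c_gt0 rl small.
  have [a [aE aN]] := @amplitude _ 1 T0 isT.
  exists 1, a; split=> //; rewrite aN; split=> //; split=> //.
  by rewrite aE; apply: le_trans exp_le.
pose Y := X `^ (2 / (4 * alpha0 + 1)).
have Y0 : 0 <= Y by exact: powR_ge0.
have BY : 1 <= B ^+ 2 * Y.
  (* Since [l <= B n], the square root of [l] is at most [B n]. *)
  have BX : 1 <= B * X.
    rewrite /X mulrA ler_pdivlMr ?sqrtr_gt0// mul1r.
    have Bn1 : 1 <= B * n%:R by have := n_ge1; nra.
    rewrite -[leRHS]ger0_norm ?(le_trans ler01)// -sqrtr_sqr ler_wsqrtr//.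
    by apply: (le_trans lB); rewrite -/B expr2; nra.
  apply: (@le_trans _ _ ((B * X) `^ (2 / (4 * alpha0 + 1)))).
    rewrite -[leLHS](powRr0 (B * X)); apply: ler_powR => //.
    by rewrite divr_ge0// addr_ge0// mulr_ge0// ltW.
  have B0 : 0 <= B by exact: le_trans B1.
  rewrite powRM//; last exact: ltW.
  rewrite -/Y ler_wpM2r// -powR_mulrn//.
  by apply: ler_powR => //; have a0 := alpha0_gt0; rewrite ler_pdivrMr; lra.
have /andP[NY YN] := truncn_itv Y0.
pose N := (Num.truncn Y).+1.
have [smooth indist] : c ^+ 2 * (l / n%:R + rate) * (2 * N%:R) `^ (2 * alpha0) <= 1 /\
    cosh (n%:R * (c ^+ 2 * (l / n%:R + rate) / N%:R)) ^+ N <= expR (2 * c ^+ 2 * l).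
  apply: (@nonparametric_level _ _ _ _ _ _ _ _ _ _ C) => //.
  - exact: ltW.
  - by rewrite /N -natr1 /C mulrDl mul1r; exact: lerD.
  - apply: le_trans c_smooth; rewrite ler_wpM2l//.
    apply: (le_trans pow_le); rewrite -[leLHS]mul1r ler_wpM2r ?powR_ge0//.
have [a [aE aN]] := @amplitude _ N T0 isT.
exists N, a; split=> //; rewrite aN; split=> //; split=> //.
by rewrite aE; apply: le_trans exp_le.
Qed.

End OneLevel.

(** * Many levels *)

Section ManyLevels.
Context {R : realType}.
Variables (K alpha0 alpha1 eta c : R) (p n : nat).
Hypotheses (hK : 2^-1 < K) (alpha0_gt0 : 0 < alpha0) (alpha01 : alpha0 < alpha1).
Hypotheses (p_ge2 : (2 <= p)%N) (hpn : ln (1 + p%:R) <= n%:R / 2%:R :> R).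
Hypotheses (c_gt0 : 0 < c) (c_le : c <= 2^-1).

Let y := loglog K n.
Let l : R := ln (p%:R * y).
Let beta0 := 2 / (4 * alpha0 + 1).
Let beta1 := 2 / (4 * alpha1 + 1).

Hypotheses (y_gt_K : K < y) (p_lt_y : p%:R < y) (y_ge_e : expR 1 <= y).
Hypothesis y_ge_alpha : 4 * (4 * alpha1 + 1) <= y.
Hypothesis y_ge_beta : 8 / (beta0 - beta1) <= y.
Hypothesis c_eta : 2 * c ^+ 2 <= eta ^+ 2.
Hypothesis c_smooth : 2 * c ^+ 2 * (2 * 1) `^ (2 * alpha1) <= 1.

Let E := expR y.

Let alpha1_gt0 : 0 < alpha1. Proof. exact: lt_trans alpha01. Qed.

Let y_ge4 : 4 <= y.
Proof. by have := alpha1_gt0; have := y_ge_alpha; lra. Qed.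

Let y_gt0 : 0 < y. Proof. by apply: lt_le_trans y_ge4. Qed.

Let n_gt0 : 0 < n%:R :> R.
Proof. by rewrite ltr0n; exact: (sample_gt0 p_ge2 hpn). Qed.

Let ln_sample : ln (n%:R : R) = E.
Proof.
have yE : y = ln (ln n%:R).
  rewrite /y /loglog; case: ifP => // H.
  by have := y_gt_K; rewrite /y /loglog H ltxx.
rewrite /E yE lnK// posrE ltNge; apply/negP => ln_le0.
by have := y_gt0; rewrite yE (ln0 ln_le0) ltxx.
Qed.

Let p_ge2R : 2 <= p%:R :> R. Proof. by rewrite ler_nat. Qed.

Let py_ge_y : y <= p%:R * y.
Proof. by have := y_gt0; have := p_ge2R; nra. Qed.

Let l_ge1 : 1 <= l.
Proof.
rewrite -(expRK (1 : R)) ler_ln ?posrE ?expR_gt0 ?(lt_le_trans y_gt0)//.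
exact: le_trans py_ge_y.
Qed.

Let l_le : l <= 2 * y.
Proof.
apply: (@le_trans _ _ (2 * ln y)).
  rewrite mulr_natl -lnXn// ler_ln ?posrE ?exprn_gt0 ?(lt_le_trans y_gt0)//.
  by rewrite expr2 ler_pM2r// ltW.
by rewrite ler_wpM2l// ltW// ln_sublinear.
Qed.

Let E_ge : y ^+ 2 / 2 <= E.
Proof. exact: expR_ge_half_sqr (ltW y_gt0). Qed.

Let X := n%:R / Num.sqrt l.
Let L := ln X.

Let l_gt0 : 0 < l. Proof. exact: lt_le_trans l_ge1. Qed.
Let X_gt0 : 0 < X. Proof. by rewrite divr_gt0// sqrtr_gt0. Qed.

Let LE : L = E - ln l / 2.
Proof.
rewrite /L /X ln_div ?posrE ?sqrtr_gt0// ln_sample; congr (_ - _).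
by rewrite -powR12_sqrt ?ltW// ln_powR mulrC.
Qed.

Let lnl : 0 <= ln l <= 2 * y.
Proof. by rewrite ln_ge0//= (le_trans _ l_le)// ltW// ln_sublinear. Qed.

Let L_ge : y ^+ 2 / 4 <= L.
Proof.
have /andP[_ ll] := lnl; rewrite LE.
by have := E_ge; have := y_ge4; move: (E) => e; nra.
Qed.

Let L_gt0 : 0 < L.
Proof. by apply: lt_le_trans L_ge; rewrite divr_gt0// exprn_gt0. Qed.

Let ln2_gt0 : 0 < ln 2 :> R. Proof. by apply: ln_gt0; rewrite ltr1n. Qed.
Let ln2_le1 : ln 2 <= 1 :> R.
Proof. by have := @le_ln1Dx R 1; rewrite -[1 + 1]/(2%:R); apply; lra. Qed.

(** Everything is compared on the logarithmic scale, where the sample size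
    [exp (exp y)] dwarfs the polynomial quantities in [y]. *)
Let rate_dominates al : alpha0 <= al <= alpha1 ->
  l / n%:R <= X `^ (- (4 * al / (4 * al + 1))).
Proof.
move=> /andP[al0 al1]; have a0 := alpha0_gt0.
have al4 : 0 < 4 * al + 1 by lra.
rewrite /powR gt_eqF// -/L -[leLHS]lnK ?posrE ?divr_gt0// ler_expR.
rewrite ln_div ?posrE// ln_sample LE; have /andP[ll0 ll] := lnl.
have ge2y : 2 * y <= E / (4 * al + 1).
  rewrite ler_pdivlMr//; apply: le_trans E_ge.
  by have := y_ge_alpha; have := y_gt0; nra.
have -> : 4 * al / (4 * al + 1) = 1 - (4 * al + 1)^-1 by field; rewrite gt_eqF.
have g1 : 0 <= (4 * al + 1)^-1 <= 1.
  by rewrite invr_ge0 ltW//= invf_le1//; lra.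
by move: g1 ge2y; move: (4 * al + 1)^-1 => g /andP[g0 g1] ge2y; nra.
Qed.

Let M := (Num.truncn y).+1.
Let mu0 := (Num.truncn (beta1 * L / ln 2)).+1.
Let beta (m : 'I_M) := (mu0 + m)%:R * ln 2 / L.
Let alpha (m : 'I_M) := (2 / beta m - 1) / 4.

Let beta1_gt0 : 0 < beta1.
Proof. by rewrite divr_gt0// addr_gt0// mulr_gt0. Qed.

Let beta01 : beta1 < beta0.
Proof.
by have a0 := alpha0_gt0; rewrite ltr_pM2l// ltf_pV2 ?posrE; have := alpha01; lra.
Qed.

Let beta_range m : beta1 <= beta m <= beta0.
Proof.
have b0 : 0 <= beta1 * L / ln 2.
  by apply: divr_ge0; [apply: mulr_ge0; exact: ltW|exact: ltW].
have /andP[tr1 tr2] := truncn_itv b0.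
have /andP[ty1 _] := truncn_itv (ltW y_gt0).
apply/andP; split.
  rewrite ler_pdivlMr// -ler_pdivrMr//; apply: (le_trans (ltW tr2)).
  by rewrite ler_nat leq_addr.
rewrite ler_pdivrMr// -ler_pdivlMr//.
have m_le : m%:R <= y by apply: le_trans ty1; rewrite ler_nat -ltnS.
apply: (@le_trans _ _ (beta1 * L / ln 2 + 1 + y)).
  by rewrite natrD lerD// /mu0 -natr1 lerD2r.
have gap : 0 < beta0 - beta1 by rewrite subr_gt0.
have : 2 * y <= (beta0 - beta1) * L / ln 2.
  apply: (@le_trans _ _ ((beta0 - beta1) * L)).
    have yb : 8 <= (beta0 - beta1) * y by rewrite mulrC -ler_pdivrMr.
    apply: (@le_trans _ _ ((beta0 - beta1) * (y ^+ 2 / 4))).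
      have := y_gt0; nra.
    by rewrite ler_wpM2l// ltW.
  rewrite ler_pdivlMr// ler_piMr// mulr_ge0// ltW//.
by have := y_ge4; rewrite !mulrBl; lra.
Qed.

Let beta_gt0 m : 0 < beta m.
Proof. by have /andP[+ _] := beta_range m; exact: lt_le_trans. Qed.

Let betaE m : beta m = 2 / (4 * alpha m + 1).
Proof.
have b0 : beta m != 0 by rewrite gt_eqF.
have -> : 4 * alpha m + 1 = 2 / beta m by rewrite /alpha; field.
by field.
Qed.

Let alpha_range m : alpha0 <= alpha m <= alpha1.
Proof.
have /andP[b1 b0] := beta_range m.
have inv (x : R) : 0 < x -> 2 / (2 / (4 * x + 1)) = 4 * x + 1.
  by move=> x0; field; rewrite gt_eqF//; lra.
have le0 : 2 / beta0 <= 2 / beta m.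
  by rewrite ler_wpM2l// lef_pV2 ?posrE// (lt_trans beta1_gt0).
have le1 : 2 / beta m <= 2 / beta1 by rewrite ler_wpM2l// lef_pV2 ?posrE.
rewrite /beta0 inv// in le0; rewrite /beta1 inv// in le1.
by rewrite /alpha; apply/andP; split; lra.
Qed.

Let alpha_gt0 m : 0 < alpha m.
Proof. by have /andP[+ _] := alpha_range m; exact: lt_le_trans. Qed.

Let exp_le : expR (2 * c ^+ 2 * l) <= 1 + eta ^+ 2 * (p * M)%:R.
Proof.
have c2 : 0 <= 2 * c ^+ 2 <= 1.
  by apply/andP; have := c_gt0; have := c_le; have := sqr_ge0 c; split; nra.
apply: (le_trans (expR_le_chord _ c2)); rewrite lnK ?posrE ?(lt_le_trans y_gt0)//.
rewrite lerD2l; have /andP[c20 _] := c2.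
have /andP[_ tr] := truncn_itv (ltW y_gt0).
apply: ler_pM => //; first by rewrite subr_ge0 (le_trans _ py_ge_y)// (le_trans _ y_ge4)// ler1n.
rewrite natrM; apply: (@le_trans _ _ (p%:R * y)); first by rewrite lerBlDr lerDl.
by rewrite ler_wpM2l// ltW.
Qed.

(** Dyadic blocks are disjoint, and [X ^ (2 / (4 alpha + 1)) = 2 ^ mu] can be
    solved for [alpha]. The admissible exponents [mu] fill an interval of length
    of order [ln X], hence of order [exp y], while [M] is only of order [y]. *)
Lemma many_levels : exists (M : nat) (N : 'I_M -> nat) (a alpha : 'I_M -> R),
  [/\ (0 < M)%N, (forall m, (0 < N m)%N),
      (forall m m', m != m' -> forall k, in_block (N m) k -> ~~ in_block (N m') k),
      (forall m, alpha0 <= alpha m <= alpha1) &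
      forall m, c ^+ 2 * tau_sparse_sq K p 1 n (alpha m) <= a m ^+ 2 * (N m)%:R /\
        a m ^+ 2 * (N m)%:R * (2 * (N m)%:R) `^ (2 * alpha m) <= 1 /\
        cosh (n%:R * a m ^+ 2) ^+ N m <= 1 + eta ^+ 2 * (p * M)%:R].
Proof.
pose N (m : 'I_M) := (2 ^ (mu0 + m))%N.
have N_gt0 m : (0 < N m)%N by rewrite expn_gt0.
pose T m := tau_sparse_sq K p 1 n (alpha m).
have TE m : T m = l / n%:R + X `^ (- (4 * alpha m / (4 * alpha m + 1))).
  by rewrite /T /tau_sparse_sq !mul1r.
have T0 m : 0 <= T m by rewrite TE addr_ge0 ?powR_ge0// divr_ge0 ?ltW.
have /choice[a aP] m := amplitude c (T0 m) (N_gt0 m).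
exists M, N, a, alpha; split=> //.
  move=> m m' mm' k; rewrite /in_block => /andP[k1 k2]; apply/negP => /andP[k1' k2'].
  have lt_pow i j : (2 ^ i <= k.+1)%N -> (k.+1 < (2 ^ j).*2)%N -> (i <= j)%N.
    move=> ik kj; have := leq_ltn_trans ik kj.
    by rewrite -mul2n -expnS ltn_exp2l.
  have : (mu0 + m == mu0 + m')%N.
    by rewrite eqn_leq (lt_pow _ _ k1 k2') (lt_pow _ _ k1' k2).
  by rewrite eqn_add2l => /eqP/val_inj/eqP; rewrite (negbTE mm').
move=> m; have [aE aN] := aP m; rewrite aN; split=> //.
have XN : X `^ (2 / (4 * alpha m + 1)) = (N m)%:R.
  rewrite -betaE /powR gt_eqF// -/L /beta divfK ?gt_eqF//.
  by rewrite [_ * ln 2]mulrC expRM_natr lnK ?posrE// natrX.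
have [smooth indist] : c ^+ 2 * T m * (2 * (N m)%:R) `^ (2 * alpha m) <= 1 /\
    cosh (n%:R * (c ^+ 2 * T m / (N m)%:R)) ^+ N m <= expR (2 * c ^+ 2 * l).
  rewrite TE; apply: (@nonparametric_level _ _ _ _ _ _ _ _ _ _ 1) => //.
  - exact: rate_dominates.
  - by rewrite XN.
  - by rewrite XN mul1r.
  - apply: le_trans c_smooth; rewrite ler_wpM2l//; first by rewrite mulr_ge0// sqr_ge0.
    have /andP[_ am] := alpha_range m.
    by apply: ler_powR; lra.
by split=> //; rewrite aE; apply: le_trans exp_le.
Qed.

End ManyLevels.

(** * The theorem *)

Theorem theorem6 (R : realType) (K alpha0 alpha1 eta : R)
    (hK : 2%:R^-1 < K)
    (halpha0 : 0 < alpha0) (halpha : alpha0 < alpha1)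
    (heta0 : 0 < eta) (heta1 : eta < 1) :
  exists c_eta : R, 0 < c_eta /\
    forall (delta : R), 0 < delta -> delta < 2%:R^-1 ->
    forall (psi : nat -> measurableTypeR R -> R), orthonormal_centered psi ->
    forall (p n : nat), (2 <= p)%N -> ln (1 + p%:R) <= n%:R / 2%:R :> R ->
    forall (d : measure_display) (Omega : measurableType d)
      (P : probability Omega R)
      (W : L2cube R p -> {RV P >-> measurableTypeR R}), white_noise W ->
    forall c : R, 0 < c -> c < c_eta ->
      ((1 - eta)%:E <=
       ereal_inf [set testing_risk psi K c delta alpha0 alpha1 n W phi
                 | phi in [set: {mfun observation R p >-> bool}]])%E.
Proof.
(* [B] bounds [l / n], and [1 + B ^ 2] the factor lost by rounding the block size
   up when there is one level. Many levels are used once [loglog n] exceeds both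
   [p] and [L0], whose summands are the thresholds that they require. *)
pose B := K + 2; pose Q := B * (2 * (1 + B ^+ 2)) `^ (2 * alpha1).
pose gap := 2 / (4 * alpha0 + 1) - 2 / (4 * alpha1 + 1).
pose L0 := K + expR 1 + 4 * (4 * alpha1 + 1) + 8 / gap.
have K_gt0 : 0 < K by apply: lt_trans hK; rewrite invr_gt0.
have alpha1_gt0 : 0 < alpha1 by exact: lt_trans halpha.
have gap_gt0 : 0 < gap.
  by rewrite subr_gt0 ltr_pM2l// ltf_pV2 ?posrE; lra.
have t1 : 1 < expR 1 :> R by rewrite expR_gt1.
have t3 : 0 < 8 / gap by rewrite divr_gt0.
have L0_ge1 : 1 <= L0 by rewrite /L0; lra.
have B_ge1 : 1 <= B by rewrite /B; lra.
have B2 : 0 <= B ^+ 2 by exact: sqr_ge0.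
have pow1 : (2 * 1) `^ (2 * alpha1) <= (2 * (1 + B ^+ 2)) `^ (2 * alpha1).
  by apply: ge0_ler_powR; rewrite ?nnegrE; lra.
have Q_gt0 : 0 < Q.
  by rewrite /Q mulr_gt0//; [lra|apply: powR_gt0; lra].
pose c_eta := Num.min 2^-1 (Num.min (eta ^+ 2 / (4 * L0)) (2 * Q)^-1).
have c_eta_gt0 : 0 < c_eta.
  rewrite /c_eta !lt_min; apply/and3P; split; first by rewrite invr_gt0.
    by apply: divr_gt0; [exact: exprn_gt0|lra].
  by rewrite invr_gt0 mulr_gt0.
exists c_eta; split=> // delta delta_gt0 delta_lt psi psi_on p n p_ge2 hpn.
move=> d Omega P W HW c c_gt0; rewrite /c_eta !lt_min.
move=> /andP[c_half /andP[c_L0 c_Q]].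
have c_le : c <= 2^-1 by exact: ltW.
have c2 : c ^+ 2 <= c by rewrite expr2 ler_piMl ?ltW//; lra.
have c_eta' : 4 * c ^+ 2 * L0 <= eta ^+ 2.
  by move: c_L0; rewrite ltr_pdivlMr; nra.
have c_smooth : 2 * c ^+ 2 * Q <= 1.
  by move: c_Q; rewrite -[(2 * Q)^-1]mul1r ltr_pdivlMr; nra.
have n_gt0 : (0 < n)%N := sample_gt0 p_ge2 hpn.
apply: le_ereal_inf_tmp => _ [phi _ <-].
have [LL_le|] := leP (loglog K n) (Num.max p%:R L0).
  have [N [a [N0 [sep [smooth indist]]]]] := one_level hK halpha0 halpha p_ge2 hpn c_gt0
    c_le L0_ge1 LL_le c_eta' c_smooth.
  apply: (@testing_risk_ge _ _ psi_on K alpha0 alpha1 delta c eta p n 1 _ _ _ _ _ _ _ _ _ _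
    HW (fun=> N) (fun=> a) (fun=> alpha0)) => //.
  - by move=> m m'; rewrite !ord1 eqxx.
  - by move=> _; rewrite lexx ltW.
  - exact: ltW.
rewrite gt_max => /andP[p_lt L0_lt].
have gtK : K < loglog K n by apply: le_lt_trans L0_lt; rewrite /L0; lra.
have ge_e : expR 1 <= loglog K n by apply: ltW; apply: le_lt_trans L0_lt; rewrite /L0; lra.
have ge_alpha : 4 * (4 * alpha1 + 1) <= loglog K n.
  by apply: ltW; apply: le_lt_trans L0_lt; rewrite /L0; lra.
have ge_beta : 8 / gap <= loglog K n.
  by apply: ltW; apply: le_lt_trans L0_lt; rewrite /L0; lra.
have c_eta2 : 2 * c ^+ 2 <= eta ^+ 2.
  by apply: le_trans c_eta'; have := sqr_ge0 c; nra.
have c_smooth2 : 2 * c ^+ 2 * (2 * 1) `^ (2 * alpha1) <= 1.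
  apply: le_trans c_smooth; rewrite ler_wpM2l//; first by rewrite mulr_ge0// sqr_ge0.
  by apply: (le_trans pow1); rewrite /Q -[leLHS]mul1r ler_wpM2r// powR_ge0.
have [M [N [a [alpha [M0 N0 disj range lev]]]]] := many_levels halpha0 halpha p_ge2
  hpn c_gt0 c_le gtK p_lt ge_e ge_alpha ge_beta c_eta2 c_smooth2.
apply: (@testing_risk_ge _ _ psi_on K alpha0 alpha1 delta c eta p n M _ _ _ _ _ _ _ _ _ _
  HW N a alpha) => //.
- exact: ltW.
- by move=> m; have [] := lev m.
- by move=> m; have [_ []] := lev m.
- by move=> m; have [_ []] := lev m.
Qed.
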